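(* Let $E=\{n_k\}_{k\ge1}\subseteq\mathbb{Z}$ be such that $|n_{k+1}/n_k|\to\infty$. Then the sequence $\{\pi_k\}$ realizes $\ell_1$-(map) in $\mathcal{C}_E(\mathbb{T})$ and $E$ is a Sidon set with constant asymptotically $1$. If the ratios $n_{k+1}/n_k$ are all integers, then the converse holds: if $\{\pi_k\}$ realizes $\ell_1$-(map) in $\mathcal{C}_E(\mathbb{T})$ and $E$ is a Sidon set with constant asymptotically $1$, then $|n_{k+1}/n_k|\to\infty$.
   Context: $\mathbb{T}=\{z\in\mathbb{C}:|z|=1\}$ with normalized Haar measure $m$; $e_n(z)=z^n$; $\widehat f(n)=\int fe_{-n}\,dm$. The $n_k$ are distinct. $\mathcal{C}_E(\mathbb{T})$ is the space of continuous complex functions on $\mathbb{T}$ whose Fourier coefficients vanish off $E$, with the sup norm. $\pi_k$ is the projection $f\mapsto\sum_{j\le k}\widehat f(n_j)e_{n_j}$ on $\mathcal{C}_E(\mathbb{T})$. The sequence $\{\pi_k\}$ realizes $\ell_1$-(map) (the metric $1$-additive approximation property) in $\mathcal{C}_E(\mathbb{T})$ if $\pi_kf\to f$ for all $f\in\mathcal{C}_E(\mathbb{T})$ and $\|f-\pi_kf\|_\infty+\|\pi_kf\|_\infty\to1$ as $k\to\infty$, uniformly for $f$ in the unit sphere of $\mathcal{C}_E(\mathbb{T})$. The Sidon constant of a set $E'\subseteq\mathbb{Z}$ is the infimum of the $C$ such that $\sum_{q\in G}|a_q|\le C\|\sum_{q\in G}a_qe_q\|_\infty$ for all finite $G\subseteq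 E'$ and $a_q\in\mathbb{C}$; $E'$ is a Sidon set if it is finite. $E$ is a Sidon set with constant asymptotically $1$ if for each $\varepsilon>0$ there is a finite set $F$ such that the Sidon constant of $E\setminus F$ is less than $1+\varepsilon$. *)

(* Defs.v *)
From HB Require Import structures.
From mathcomp Require Export all_boot all_order all_algebra finmap.
From mathcomp Require Export all_classical all_reals all_analysis.
From mathcomp Require Export complex.

Set Implicit Arguments.
Unset Strict Implicit.
Unset Printing Implicit Defensive.

Export Order.TTheory GRing.Theory Num.Theory.
Export numFieldNormedType.Exports.

Open Scope classical_set_scope.
Open Scope ring_scope.
Open Scope complex_scope.

(* Functions on the circle are represented by functions f : R[i]^o -> R[i]^o,
   of which only the values on [circle] matter; the alias ^o gives R[i] the
   topology of its norm.  [normc] is the modulus with values in R, whereas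
   `|z| has values in R[i]. *)

Definition circle (R : realType) : set R[i]^o := [set z | Normc.normc z = 1].
Arguments circle R : clear implicits.

Definition expi (R : realType) (t : R) : R[i] := cos t +i* sin t.

(* Integral against the normalized Haar measure of the circle, i.e. the image
   of the Lebesgue measure of [0, 1] under t |-> exp(2 i pi t). *)
Definition circle_integral (R : realType) (f : R[i]^o -> R[i]^o) : R[i] :=
  (\int[@lebesgue_measure R]_(t in `[0, 1]) complex.Re (f (expi (2 * pi * t))))
  +i*
  (\int[@lebesgue_measure R]_(t in `[0, 1]) complex.Im (f (expi (2 * pi * t)))).

Definition char_fun (R : realType) (q : int) : R[i]^o -> R[i]^o :=
  fun z => z ^ q.

Definition fourier_coef (R : realType) (f : R[i]^o -> R[i]^o) (q : int) :
    R[i] :=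
  circle_integral (fun z => f z * char_fun (- q) z).

Definition supnorm (R : realType) (f : R[i]^o -> R[i]^o) : R :=
  sup [set Normc.normc (f z) | z in circle R].

Definition CE (R : realType) (E : set int) : set (R[i]^o -> R[i]^o) :=
  [set f | {within circle R, continuous f} /\
           forall q : int, ~ E q -> fourier_coef f q = 0].

(* The enumeration of E is indexed from 0, so [n j] stands for n_{j+1} and
   [proj n k] is the sum over the first k elements, that is pi_k. *)
Definition proj (R : realType) (n : nat -> int) (k : nat)
    (f : R[i]^o -> R[i]^o) : R[i]^o -> R[i]^o :=
  fun z => \sum_(j < k) fourier_coef f (n j) * char_fun (n j) z.

Definition realizes_l1map (R : realType) (n : nat -> int) : Prop :=
  (forall f : R[i]^o -> R[i]^o, CE (range n) f ->
     supnorm (f \- proj n k f) @[k --> \oo] --> (0 : R)) /\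
  (forall eps : R, 0 < eps ->
     \forall k \near \oo, forall f : R[i]^o -> R[i]^o,
       CE (range n) f -> supnorm f = 1 ->
       `|supnorm (f \- proj n k f) + supnorm (proj n k f) - 1| < eps).

(* The value is +oo when no constant is admissible, i.e. when A is not a
   Sidon set. *)
Definition sidon_constant (R : realType) (A : set int) : \bar R :=
  ereal_inf [set C%:E | C in [set C : R |
    forall (G : {fset int}) (a : int -> R[i]), [set` G] `<=` A ->
      \sum_(q <- G) Normc.normc (a q) <=
        C * supnorm (fun z => \sum_(q <- G) a q * char_fun q z)]].

Definition sidon_asymptotically_1 (R : realType) (E : set int) : Prop :=
  forall eps : R, 0 < eps ->
    exists F : set int, finite_set F /\
      (sidon_constant R (E `\` F) < (1 + eps)%:E)%E.

(* If n k = 0, which for an injective n happens for at most one k, the quotient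
   is 0 by convention; this has no effect on its limit. *)
Definition ratio (R : realType) (n : nat -> int) (k : nat) : R :=
  (n k.+1)%:~R / (n k)%:~R.

(* Main.v *)
Require Import Defs.
From mathcomp Require Import ring lra zify.

Set Implicit Arguments.
Unset Strict Implicit.
Unset Printing Implicit Defensive.

(** Suppose |n_(k+1)| >= M |n_k| from some index N on, with M large. An arc of length of order
    1/|n_k| is wrapped around the whole circle by the k-th character, while the earlier characters
    hardly move on it. Hence ([steer]), close to any x there is a y at which finitely many
    consecutive characters from N on take prescribed unimodular values up to O(1/M). Prescribing
    values that cancel the phases of the coefficients b_j brings a polynomial in these characters
    within O(1/M), relatively, of any chosen unimodular multiple of the sum of the |b_j|. This gives
    Sidon constants near 1 ([sidon_lacunary]).

    If a head p of degree below k precedes this tail, p barely changes between x and y, since the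
    sum of the |n_j| for j < k is small against |n_k|. Aligning the tail with the phase of p(x)
    gives |p(x)| + (1 - O(1/M)) sum |b_j| <= (1 + O(1/M)) S, where S is the sup norm of the whole
    polynomial ([trig_poly_additive]). A general f in C_E is reached through its de la Vallee
    Poussin means: polynomials with spectrum in E, bounded by the norm of f, whose coefficients tend
    to those of f ([proj_additive]). So the Fourier series of f converges absolutely, its tail
    dominates f - pi_k f ([subproj_le]), and both halves of the approximation property follow.

    For the converse, if the integer ratios do not tend to infinity in modulus, some integer s,
    necessarily different from 1, is a ratio infinitely often. Fix w with w^(s-1) = -1. Outside any
    finite set there are frequencies forming the polynomial u + u^s + w (v + v^s), with u and v
    characters. Its four terms can never all agree, as this would force u^(s-1) = v^(s-1) = 1 and u
    = w v, hence 1 = -1. Its norm therefore stays below 4 by an amount depending on s alone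
    ([normc_sum4_lt]), which keeps the Sidon constants away from 1. *)

Local Notation normc := Normc.normc.

                   

(** * Modulus and phase of complex numbers *)

Section Modulus.
Variable R : realType.
Implicit Types x y z : R[i].

Lemma normc_ge0 z : 0 <= normc z.
Proof. by case: z => a b; exact: sqrtr_ge0. Qed.

Lemma sqr_normc_ReIm z :
  normc z ^+ 2 = complex.Re z ^+ 2 + complex.Im z ^+ 2.
Proof. by case: z => a b /=; rewrite sqr_sqrtr// addr_ge0// sqr_ge0. Qed.

Lemma ler_normcD x y : normc (x + y) <= normc x + normc y.
Proof. exact: (@le_normcD R x y). Qed.

Lemma normc_opp z : normc (- z) = normc z.
Proof. exact: (@normcN R z). Qed.

Lemma normc_distC x y : normc (x - y) = normc (y - x).
Proof. by rewrite -normc_opp opprB. Qed.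

Lemma ler_normcB_add x y z : normc (x - z) <= normc (x - y) + normc (y - z).
Proof. by rewrite -{1}(subrK y x) -addrA ler_normcD. Qed.

Lemma lerB_normcD x y : normc x - normc y <= normc (x + y).
Proof. by rewrite lerBlDr -{1}(addrK y x) -(normc_opp y) ler_normcD. Qed.

Lemma normc_real (a : R) : normc a%:C = `|a|.
Proof. by rewrite /= expr0n addr0 sqrtr_sqr. Qed.

Lemma ler_Re_normc z : `|complex.Re z| <= normc z.
Proof.
by rewrite -(ger0_norm (normc_ge0 z)) -ler_sqr// ?nnegrE//
  !real_normK ?num_real// sqr_normc_ReIm lerDl sqr_ge0.
Qed.

Lemma ler_Im_normc z : `|complex.Im z| <= normc z.
Proof.
by rewrite -(ger0_norm (normc_ge0 z)) -ler_sqr// ?nnegrE//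
  !real_normK ?num_real// sqr_normc_ReIm lerDr sqr_ge0.
Qed.

Lemma ler_normc_ReIm z : normc z <= `|complex.Re z| + `|complex.Im z|.
Proof.
case: z => a b.
rewrite (_ : a +i* b = a%:C + (0 +i* b)); last by simpc.
apply: le_trans (ler_normcD _ _) _; rewrite normc_real /= expr0n add0r sqrtr_sqr.
by rewrite addr0 add0r.
Qed.

Lemma normcX z (k : nat) : normc (z ^+ k) = normc z ^+ k.
Proof.
by elim: k => [|k IH]; rewrite ?Normc.normc1// !exprS Normc.normcM IH.
Qed.

Lemma ler_normc_sum (I : Type) (r : seq I) (P : pred I) (F : I -> R[i]) :
  normc (\sum_(i <- r | P i) F i) <= \sum_(i <- r | P i) normc (F i).
Proof.
elim/big_ind2 : _ => //; first by rewrite Normc.normc0.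
move=> x1 y1 x2 y2 h1 h2; exact: le_trans (ler_normcD _ _) (lerD h1 h2).
Qed.

Lemma ReD x y : complex.Re (x + y) = complex.Re x + complex.Re y.
Proof. by case: x => ? ?; case: y. Qed.

Lemma ImD x y : complex.Im (x + y) = complex.Im x + complex.Im y.
Proof. by case: x => ? ?; case: y. Qed.

Lemma ReM x y :
  complex.Re (x * y) = complex.Re x * complex.Re y - complex.Im x * complex.Im y.
Proof. by case: x => ? ?; case: y. Qed.

Lemma ImM x y :
  complex.Im (x * y) = complex.Re x * complex.Im y + complex.Im x * complex.Re y.
Proof. by case: x => ? ?; case: y. Qed.

(** The value 1 at zero keeps the phase on the circle in all cases, so that its inverse can always
    serve as a target value for a character. *)
Definition phase z : R[i] := if z == 0 then 1 else z / (normc z)%:C.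

Lemma normc_phase z : normc (phase z) = 1.
Proof.
rewrite /phase; case: eqVneq => [_|z0]; first exact: Normc.normc1.
have nz0 : normc z != 0 by apply: contra_neq z0; exact: Normc.eq0_normc.
rewrite Normc.normcM Normc.normcV normc_real ger0_norm ?normc_ge0//.
by rewrite divff.
Qed.

Lemma phaseM z : phase z * (normc z)%:C = z.
Proof.
rewrite /phase; case: eqVneq => [->|z0]; first by rewrite Normc.normc0 mulr0.
have nz0 : normc z != 0 by apply: contra_neq z0; exact: Normc.eq0_normc.
by rewrite divfK// -[0](rmorph0 (real_complex R)) (inj_eq (@complexI R)).
Qed.

Lemma phaseV z : (phase z)^-1 * z = (normc z)%:C.
Proof.
have p0 : phase z != 0.
  by apply: contra_eq_neq (normc_phase z) => ->; rewrite Normc.normc0 eq_sym oner_neq0.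
by rewrite -[X in _ * X]phaseM mulKf.
Qed.

End Modulus.

(** * The unit circle, its parametrization and roots on it *)

Section Circle.
Variable R : realType.
Implicit Types z w : R[i].

Lemma circle_neq0 z : circle R z -> z != 0.
Proof.
by move=> h; apply: contra_eq_neq h => ->; rewrite Normc.normc0 eq_sym oner_neq0.
Qed.

Lemma circle1 : circle R 1. Proof. exact: Normc.normc1. Qed.

Lemma circleM (x y : R[i]) : circle R x -> circle R y -> circle R (x * y).
Proof. by rewrite /circle /= Normc.normcM => -> ->; rewrite mulr1. Qed.

Lemma circleV (x : R[i]) : circle R x -> circle R x^-1.
Proof. by rewrite /circle /= Normc.normcV => ->; rewrite invr1. Qed.

Lemma circleXn (x : R[i]) (k : nat) : circle R x -> circle R (x ^+ k).
Proof. by rewrite /circle /= normcX => ->; rewrite expr1n. Qed.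

Lemma circleX (x : R[i]) (q : int) : circle R x -> circle R (x ^ q).
Proof.
by case: q => k cx; [|apply: circleV]; apply: circleXn.
Qed.

Lemma circle_phase z : circle R (phase z). Proof. exact: normc_phase. Qed.

Lemma normcZ_circle (x z : R[i]) : circle R x -> normc (x * z) = normc z.
Proof. by move=> cx; rewrite Normc.normcM cx mul1r. Qed.

Lemma normc_subV (x y : R[i]) : circle R x -> circle R y ->
  normc (x^-1 - y^-1) = normc (x - y).
Proof.
move=> cx cy; have x0 := circle_neq0 cx; have y0 := circle_neq0 cy.
rewrite -(normcZ_circle _ (circleM cx cy)) mulrBr mulrAC divff// mul1r.
by rewrite mulfK// normc_distC.
Qed.

Lemma normc_subXn (x y : R[i]) (k : nat) : circle R x -> circle R y ->
  normc (x ^+ k - y ^+ k) <= k%:R * normc (x - y).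
Proof.
move=> cx cy; elim: k => [|k IH]; first by rewrite !expr0 subrr Normc.normc0 mul0r.
rewrite !exprS.
have -> : x * x ^+ k - y * y ^+ k = x * (x ^+ k - y ^+ k) + y ^+ k * (x - y) by ring.
apply: le_trans (ler_normcD _ _) _.
rewrite !normcZ_circle//; last exact: circleXn.
by rewrite -natr1 mulrDl mul1r lerD2r.
Qed.

Lemma normc_subX (x y : R[i]) (q : int) : circle R x -> circle R y ->
  normc (x ^ q - y ^ q) <= `|q|%:~R * normc (x - y).
Proof.
move=> cx cy; case: q => k /=; first exact: normc_subXn.
by rewrite NegzE -!invr_expz normc_subV ?normrN; first exact: normc_subXn;
  apply: circleXn.
Qed.

Lemma expi_circle t : circle R (expi t).
Proof. by rewrite /circle /= /expi /= cos2Dsin2 sqrtr1. Qed.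

Lemma expiD (s t : R) : expi (s + t) = expi s * expi t.
Proof.
rewrite /expi sinD cosD; simpc; congr (_ +i* _); ring.
Qed.

Lemma expi0 : expi (0 : R) = 1.
Proof. by rewrite /expi sin0 cos0. Qed.

Lemma expiN (t : R) : expi (- t) = (expi t)^-1.
Proof.
have e0 := circle_neq0 (expi_circle t); apply: (mulfI e0).
by rewrite divff// -[RHS]expi0 -(subrr t) expiD.
Qed.

Lemma expiXn (t : R) (k : nat) : expi t ^+ k = expi (k%:R * t).
Proof.
elim: k => [|k IH]; first by rewrite mul0r expi0.
by rewrite exprS IH -natr1 mulrDl mul1r addrC expiD.
Qed.

Lemma expiX (t : R) (q : int) : expi t ^ q = expi (q%:~R * t).
Proof.
case: q => k; first exact: expiXn.
by rewrite NegzE -invr_expz -exprnP expiXn -expiN mulrNz mulNr.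
Qed.

Lemma expi_2pi : expi (2 * pi : R) = 1.
Proof. by rewrite mulrC mulr_natr /expi cos2pi sin2pi. Qed.

Lemma expi_surj z : circle R z -> exists t, z = expi t.
Proof.
case: z => a b; rewrite /circle /= => h.
have {}h : a ^+ 2 + b ^+ 2 = 1.
  by rewrite -[LHS]sqr_sqrtr ?addr_ge0 ?sqr_ge0// h expr1n.
have a1 : -1 <= a <= 1 by apply/andP; split; nra.
have bE : sin (acos a) = `|b|.
  by rewrite sin_acos// -h addrAC subrr add0r sqrtr_sqr.
have [b0|b0] := leP 0 b; [exists (acos a)|exists (- acos a)].
  by rewrite /expi acosK// bE ger0_norm.
by rewrite /expi cosN sinN acosK// bE ltr0_norm ?opprK.
Qed.

Lemma ler_cosB (s t : R) : `|cos s - cos t| <= `|s - t|.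
Proof.
wlog st : s t / s <= t.
  by move=> H; case: (leP s t) => [/H//|/ltW/H]; rewrite distrC (distrC t).
have [|c _ e] := @MVT_segment R cos (fun x => - sin x) s t st _.
  by apply: continuous_subspaceT => x; exact: continuous_cos.
rewrite distrC e normrM normrN distrC.
by rewrite -[leRHS]mul1r ler_wpM2r// sin_max.
Qed.

Lemma ler_sinB (s t : R) : `|sin s - sin t| <= `|s - t|.
Proof.
rewrite -!cosBpihalf; apply: le_trans (ler_cosB _ _) _.
by rewrite opprB addrA subrK.
Qed.

Lemma normc_expiB (s t : R) : normc (expi s - expi t) <= 2 * `|s - t|.
Proof.
apply: le_trans (ler_normc_ReIm _) _; rewrite /expi /=.
by have := ler_cosB s t; have := ler_sinB s t; lra.
Qed.

(** The q-th roots of w are spaced by the angle 2 pi / |q|, so one of them lies within that angle of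
    x. The remaining factor 2 comes from the crude chord estimate [normc_expiB]. *)
Lemma circle_root_near (x w : R[i]) (q : int) : circle R x -> circle R w -> q != 0 ->
  exists2 y, circle R y & y ^ q = w /\ normc (y - x) <= 4 * pi / `|q|%:~R.
Proof.
move=> /expi_surj[s ->] /expi_surj[p ->] q0.
have pi0 := pi_gt0 R.
have q0R : q%:~R != 0 :> R by rewrite intr_eq0.
(* This picks the branch of the root: p + 2 pi m is the argument of w just below q s, so q u and q s
   differ by at most 2 pi. *)
pose m := Num.floor ((q%:~R * s - p) / (2 * pi)).
pose u := (p + 2 * pi * m%:~R) / q%:~R.
exists (expi u); first exact: expi_circle.
split.
  rewrite expiX /u mulrC divfK// expiD mulrC -[RHS]mul1r; congr (_ * _).
  by rewrite mulrC -expiX expi_2pi exp1rz.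
apply: le_trans (normc_expiB _ _) _.
rewrite intr_norm ler_pdivlMr ?normr_gt0// -mulrA -normrM mulrBl /u divfK//.
have := floor_le ((q%:~R * s - p) / (2 * pi)).
have := floorD1_gt ((q%:~R * s - p) / (2 * pi)).
rewrite -/m ltr_pdivrMr ?mulr_gt0// intrD ler_pdivlMr ?mulr_gt0// => h1 h2.
rewrite (_ : 4 * pi = 2 * (2 * pi)); last by ring.
rewrite ler_pM2l// ler_norml; nra.
Qed.

End Circle.

                                           

(** * Continuous functions on the circle and the sup norm *)

Section ContinuousOnCircle.
Variable R : realType.
Implicit Types f g : R[i]^o -> R[i]^o.

                                                                             
(** An epsilon-delta form with real radii and the real-valued modulus, in which continuity within
    the circle is used from here on. *)
Definition circle_continuous f : Prop :=
  forall x : R[i], circle R x -> forall eps : R, 0 < eps ->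
  exists2 delta : R, 0 < delta &
    forall y : R[i], circle R y -> normc (y - x) < delta ->
      normc (f y - f x) < eps.

Lemma circle_continuousP f :
  {within circle R, continuous f} -> circle_continuous f.
Proof.
move=> /subspace_continuousP cf x cx eps e0.
have /cvgrPdist_lt/(_ eps%:C) := cf x cx.
rewrite ltcR => /(_ e0); rewrite near_withinE => /nbhs_ballP[d d0 H].
(* The radius of the ball is a complex number; being positive for the order of [R[i]], it has no
   imaginary part. *)
have dE : d = (complex.Re d)%:C.
  by move: d0; case: (d) => a b; rewrite /= ltcE /= => /andP[/eqP-> _].
exists (complex.Re d); first by rewrite -ltcR -dE.
move=> y cy yx.
have {}yx : `|x - y| < d by rewrite dE distrC ltcR.
by have /= := H y yx cy; rewrite distrC ltcR.
Qed.

Lemma circle_continuous_cst (c : R[i]) : circle_continuous (fun=> c).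
Proof.
by move=> x cx e e0; exists 1 => // y _ _; rewrite subrr Normc.normc0.
Qed.

Lemma circle_continuousD f g : circle_continuous f -> circle_continuous g ->
  circle_continuous (fun z => f z + g z).
Proof.
move=> cf cg x cx e e0.
have [|d d0 Hf] := cf x cx (e / 2); first by lra.
have [|d' d'0 Hg] := cg x cx (e / 2); first by lra.
exists (Num.min d d'); first by rewrite lt_min d0.
move=> y cy; rewrite lt_min => /andP[/(Hf _ cy) h1 /(Hg _ cy) h2].
rewrite opprD addrACA; apply: le_lt_trans (ler_normcD _ _) _.
by rewrite (splitr e) ltrD.
Qed.

Lemma circle_continuousM f g : circle_continuous f -> circle_continuous g ->
  circle_continuous (fun z => f z * g z).
Proof.
move=> cf cg x cx e e0.
pose A := normc (f x) + 1; pose B := normc (g x) + 1.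
have A0 : 0 < A by rewrite /A; have := normc_ge0 (f x); lra.
have B0 : 0 < B by rewrite /B; have := normc_ge0 (g x); lra.
have [|d d0 Hf] := cf x cx (e / 2 / B); first by rewrite !divr_gt0.
have [|d' d'0 Hg] := cg x cx (Num.min 1 (e / 2 / A)).
  by rewrite lt_min ltr01 !divr_gt0.
exists (Num.min d d'); first by rewrite lt_min d0.
move=> y cy; rewrite lt_min => /andP[/(Hf _ cy) h1 /(Hg _ cy)].
rewrite lt_min => /andP[g1 h2].
have -> : f y * g y - f x * g x = (f y - f x) * g y + f x * (g y - g x) :> R[i].
  by ring.
apply: le_lt_trans (ler_normcD _ _) _; rewrite !Normc.normcM (splitr e).
have gyB : normc (g y) <= B.
  have := ler_normcD (g y - g x) (g x); rewrite subrK /B; lra.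
apply: ltr_leD; last first.
  move: h2; rewrite ltr_pdivlMr// => /ltW; apply: le_trans.
  by rewrite mulrC ler_wpM2l ?normc_ge0// /A; lra.
move: h1; rewrite ltr_pdivlMr// => h1; apply: le_lt_trans h1.
by rewrite ler_wpM2l ?normc_ge0.
Qed.

Lemma circle_continuous_sum (I : Type) (r : seq I) (P : pred I)
    (F : I -> R[i]^o -> R[i]^o) : (forall i, circle_continuous (F i)) ->
  circle_continuous (fun z => \sum_(i <- r | P i) F i z).
Proof.
move=> cF; elim: r => [|i r IH].
  rewrite (_ : (fun _ => _) = (fun=> 0)); first exact: circle_continuous_cst.
  by apply/funext => z; rewrite big_nil.
rewrite (_ : (fun _ => _) =
  (fun z => (if P i then F i z else 0) + \sum_(j <- r | P j) F j z)); last first.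
  by apply/funext => z; rewrite big_cons; case: ifP => //; rewrite add0r.
by apply: circle_continuousD => //; case: (P i) => //; exact: circle_continuous_cst.
Qed.

Lemma circle_continuous_char q : circle_continuous (@char_fun R q).
Proof.
move=> x cx e e0.
have k0 : 0 < `|q|%:~R + 1 :> R by rewrite ltr_wpDl// ler0z normr_ge0.
exists (e / (`|q|%:~R + 1)); first exact: divr_gt0.
move=> y cy; rewrite ltr_pdivlMr// => h.
apply: le_lt_trans (normc_subX _ cy cx) _.
by apply: le_lt_trans h; rewrite mulrC ler_wpM2l ?normc_ge0// lerDl.
Qed.

Lemma circle_continuous_line f (phi : R[i] -> R) : circle_continuous f ->
  (forall z w, `|phi z - phi w| <= normc (z - w)) ->
  continuous (fun t : R => phi (f (expi (2 * pi * t)))).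
Proof.
move=> cf phi1 t; apply/cvgrPdist_lt => e e0.
have [d d0 H] := cf _ (expi_circle (2 * pi * t)) e e0.
have pi0 := pi_gt0 R.
near=> s.
apply: le_lt_trans (phi1 _ _) _; rewrite normc_distC; apply: H.
  exact: expi_circle.
apply: le_lt_trans (normc_expiB _ _) _.
rewrite -mulrBr normrM ger0_norm; last by lra.
rewrite mulrA mulrC -ltr_pdivlMr; last by lra.
rewrite distrC; near: s; apply: cvgr_dist_lt => //.
by rewrite divr_gt0//; lra.
Unshelve. all: by end_near.
Qed.

Lemma circle_continuous_Re f : circle_continuous f ->
  continuous (fun t : R => complex.Re (f (expi (2 * pi * t)))).
Proof.
move=> cf; apply: circle_continuous_line => // z w.
by rewrite (_ : _ - _ = complex.Re (z - w)) ?ler_Re_normc//; case: z; case: w.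
Qed.

Lemma circle_continuous_Im f : circle_continuous f ->
  continuous (fun t : R => complex.Im (f (expi (2 * pi * t)))).
Proof.
move=> cf; apply: circle_continuous_line => // z w.
by rewrite (_ : _ - _ = complex.Im (z - w)) ?ler_Im_normc//; case: z; case: w.
Qed.

Lemma expi_surj01 (z : R[i]) : circle R z ->
  exists2 t, 0 <= t <= 1 & z = expi (2 * pi * t).
Proof.
move=> /expi_surj[s ->]; have pi0 := pi_gt0 R.
pose m := Num.floor (s / (2 * pi)).
exists (s / (2 * pi) - m%:~R).
  have := floorD1_gt (s / (2 * pi)); rewrite -/m intrD => h.
  by rewrite subr_ge0 floor_le/=; lra.
rewrite mulrBr mulrC divfK; last by rewrite gt_eqF//; lra.
rewrite expiD -[LHS]mulr1; congr (_ * _).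
by rewrite expiN mulrC -expiX expi_2pi exp1rz invr1.
Qed.

(** Compactness enters through the parametrization of the circle by [0, 1] and the extreme value
    theorem. Boundedness is what makes [sup] an actual upper bound. *)
Lemma supnorm_has_sup f : circle_continuous f ->
  has_sup [set normc (f z) | z in circle R].
Proof.
move=> cf; split; first by exists (normc (f 1)); exists 1 => //; exact: circle1.
have [|c _ H] := @EVT_max R (fun t => normc (f (expi (2 * pi * t)))) 0 1 ler01.
  apply: continuous_subspaceT; apply: circle_continuous_line => // z w.
  have := ler_normcD (z - w) w; have := ler_normcD (w - z) z.
  by rewrite !subrK (normc_distC w) => h1 h2; rewrite ler_norml; lra.
exists (normc (f (expi (2 * pi * c)))) => _ [z /expi_surj01[t t01 ->] <-].
by apply: H; rewrite in_itv.
Qed.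

Lemma supnorm_ge f (z : R[i]) : circle_continuous f -> circle R z ->
  normc (f z) <= supnorm f.
Proof.
move=> cf cz; apply: sup_upper_bound; first exact: supnorm_has_sup.
by exists z.
Qed.

Lemma supnorm_le f (M : R) : (forall z, circle R z -> normc (f z) <= M) ->
  supnorm f <= M.
Proof.
move=> H; apply: ge_sup; first by exists (normc (f 1)); exists 1 => //; exact: circle1.
by move=> _ [z cz <-]; exact: H.
Qed.

Lemma supnorm_ge0 f : circle_continuous f -> 0 <= supnorm f.
Proof. by move=> cf; exact: le_trans (normc_ge0 _) (supnorm_ge cf (circle1 R)). Qed.

End ContinuousOnCircle.

                             

(** * Integration on the circle and orthogonality of the characters *)

Section CircleIntegral.
Variable R : realType.
Implicit Types f g : R[i]^o -> R[i]^o.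
Local Notation mu := (@lebesgue_measure R).

Lemma continuous_integrable01 (h : R -> R) : continuous h ->
  mu.-integrable `[0, 1] (EFin \o h).
Proof.
move=> ch; apply: continuous_compact_integrable; first exact: segment_compact.
exact: continuous_subspaceT.
Qed.

Lemma eq_circle_integral f g : (forall z, circle R z -> f z = g z) ->
  circle_integral f = circle_integral g.
Proof.
move=> fg; rewrite /circle_integral.
by congr (_ +i* _); apply: eq_Rintegral => t _; rewrite fg//; exact: expi_circle.
Qed.

Lemma circle_integral_cst (c : R[i]) : circle_integral (fun=> c) = c.
Proof.
rewrite /circle_integral !Rintegral_cst//= lebesgue_measure_itv/= lte_fin ltr01.
by rewrite -EFinB subr0 /= !mulr1; case: c.
Qed.

Lemma circle_integralD f g : circle_continuous f -> circle_continuous g ->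
  circle_integral (fun z => f z + g z) = circle_integral f + circle_integral g.
Proof.
move=> cf cg; rewrite /circle_integral; simpc; congr (_ +i* _).
- rewrite -RintegralD//; first (by apply: eq_Rintegral => t _; exact: ReD);
    by apply: continuous_integrable01; exact: circle_continuous_Re.
- rewrite -RintegralD//; first (by apply: eq_Rintegral => t _; exact: ImD);
    by apply: continuous_integrable01; exact: circle_continuous_Im.
Qed.

Lemma circle_integralZ (c : R[i]) f : circle_continuous f ->
  circle_integral (fun z => c * f z) = c * circle_integral f.
Proof.
move=> cf; case: c => a b.
have iR := continuous_integrable01 (circle_continuous_Re cf).
have iI := continuous_integrable01 (circle_continuous_Im cf).
have iZ (r : R) (h : R -> R) : mu.-integrable `[0, 1] (EFin \o h) ->
    mu.-integrable `[0, 1] (EFin \o (fun x => r * h x)).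
  move=> ih; rewrite (_ : EFin \o _ = (fun x => r%:E * (EFin \o h) x)%E).
    exact: integrableZl.
  by apply/funext => x /=; rewrite EFinM.
rewrite /circle_integral; simpc; congr (_ +i* _).
- rewrite -!RintegralZl// -RintegralB//; [|exact: iZ|exact: iZ].
  by apply: eq_Rintegral => t _; exact: ReM.
- rewrite -!RintegralZl// -RintegralD//; [|exact: iZ|exact: iZ].
  by apply: eq_Rintegral => t _; exact: ImM.
Qed.

Lemma circle_integral_sum (I : Type) (r : seq I) (F : I -> R[i]^o -> R[i]^o) :
  (forall i, circle_continuous (F i)) ->
  circle_integral (fun z => \sum_(i <- r) F i z) =
  \sum_(i <- r) circle_integral (F i).
Proof.
move=> cF; elim: r => [|i r IH].
  rewrite big_nil -[RHS]circle_integral_cst.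
  by apply: eq_circle_integral => z _; rewrite big_nil.
rewrite big_cons -IH -circle_integralD//; last exact: circle_continuous_sum.
by apply: eq_circle_integral => z _; rewrite big_cons.
Qed.

                                                                                 
                                                    
(** Rotating f by a constant u makes its integral real and nonnegative; then Re (u f) <= |f| <= Re g
    is integrated. The bound is the real part of a complex function so that the complex-valued
    kernels below can be inserted directly. *)
Lemma ler_normc_circle_integral f g :
  circle_continuous f -> circle_continuous g ->
  (forall z, circle R z -> normc (f z) <= complex.Re (g z)) ->
  normc (circle_integral f) <= complex.Re (circle_integral g).
Proof.
move=> cf cg fg.
pose u := (phase (circle_integral f))^-1.
have cu : circle R u by apply: circleV; exact: circle_phase.
have cuf : circle_continuous (fun z => u * f z).
  by apply: circle_continuousM => //; exact: circle_continuous_cst.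
have -> : normc (circle_integral f) =
          complex.Re (circle_integral (fun z => u * f z)).
  by rewrite circle_integralZ// phaseV.
rewrite /circle_integral /=; apply: le_Rintegral => //.
- exact: continuous_integrable01 (circle_continuous_Re cuf).
- exact: continuous_integrable01 (circle_continuous_Re cg).
- move=> t _; have ct := expi_circle (2 * pi * t).
  apply: le_trans (ler_norm _) (le_trans (ler_Re_normc _) _).
  by rewrite normcZ_circle// fg.
Qed.

Lemma Rintegral_cos_sin (k : R) : k != 0 ->
  \int[mu]_(t in `[0, 1]) cos (k * t) = sin k / k /\
  \int[mu]_(t in `[0, 1]) sin (k * t) = (1 - cos k) / k.
Proof.
move=> k0.
have dk (t : R) : is_derive t (1 : R) (fun s : R => k * s) k.
  by apply: is_derive_eq; rewrite /GRing.scale/= mulr1.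
have dcomp (h dh : R -> R) (a t : R) : (forall s, is_derive s (1 : R) h (dh s)) ->
    is_derive t (1 : R) (fun s : R => a * h (k * s)) (a * (dh (k * t) * k)).
  move=> H; have := @is_deriveZ R R R (fun s => h (k * s)) a t 1 (dh (k * t) * k).
  by apply; exact: (@is_derive1_comp _ h _ t (dh (k * t)) k).
have FTC (F h : R -> R) : continuous h ->
    (forall t, is_derive t (1 : R) F (h t)) ->
    \int[mu]_(t in `[0, 1]) h t = F 1 - F 0.
  move=> ch dF.
  have cF (t : R) : {for t, continuous F}.
    by apply: differentiable_continuous; apply/derivable1_diffP; case: (dF t).
  rewrite /Rintegral (@continuous_FTC2 _ _ F) //.
  - exact: continuous_subspaceT.
  - split.
    + by move=> x _; case: (dF x).
    + by apply: cvg_at_right_filter; exact: cF.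
    + by apply: cvg_at_left_filter; exact: cF.
  - by move=> x _; rewrite derive1E; case: (dF x).
have ck : continuous (fun s : R => k * s) by move=> t; exact: mulrl_continuous.
split.
- transitivity (k^-1 * sin (k * 1) - k^-1 * sin (k * 0)); last first.
    by rewrite mulr0 sin0 mulr0 subr0 mulr1 mulrC.
  apply: (FTC (fun t => k^-1 * sin (k * t))) => t.
    by apply: continuous_comp; [exact: ck|exact: continuous_cos].
  have := dcomp sin cos k^-1 t (@is_derive_sin R).
  by rewrite mulrC mulfK.
- transitivity (- k^-1 * cos (k * 1) - (- k^-1) * cos (k * 0)); last first.
    by rewrite mulr0 cos0 !mulr1 mulNr opprK addrC mulrBl mul1r mulrC.
  apply: (FTC (fun t => - k^-1 * cos (k * t))) => t.
    by apply: continuous_comp; [exact: ck|exact: continuous_sin].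
  have := dcomp cos (fun x => - sin x) (- k^-1) t (@is_derive_cos R).
  by rewrite !mulNr mulrN opprK mulrC mulfK.
Qed.

Lemma circle_integral_char q :
  circle_integral (@char_fun R q) = (q == 0)%:R.
Proof.
case: eqVneq => [->|q0].
  rewrite -[RHS](circle_integral_cst 1).
  by apply: eq_circle_integral => z _; rewrite /char_fun expr0z.
pose k : R := q%:~R * (2 * pi).
have pi0 := pi_gt0 R.
have k0 : k != 0 by rewrite mulf_neq0 ?intr_eq0// gt_eqF//; lra.
have ek : expi k = 1 by rewrite -expiX expi_2pi exp1rz.
have [ck sk] := Rintegral_cos_sin k0.
have E t : char_fun q (expi (2 * pi * t)) = expi (k * t).
  by rewrite /char_fun expiX mulrA.
rewrite /circle_integral.
under eq_Rintegral do rewrite E.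
under [X in _ +i* X]eq_Rintegral do rewrite E.
rewrite /= ck sk; case: ek => -> ->.
by rewrite mul0r subrr mul0r.
Qed.

Lemma circle_continuous_mul_char f q : circle_continuous f ->
  circle_continuous (fun z => f z * char_fun q z).
Proof.
by move=> cf; apply: circle_continuousM => //; exact: circle_continuous_char.
Qed.

Lemma fourier_coef_char (p q : int) :
  fourier_coef (@char_fun R p) q = (p == q)%:R.
Proof.
rewrite /fourier_coef -(subr_eq0 p) -circle_integral_char.
apply: eq_circle_integral => z cz.
by rewrite /char_fun expfzDr ?circle_neq0.
Qed.

Lemma ler_fourier_coef f q : circle_continuous f ->
  normc (fourier_coef f q) <= supnorm f.
Proof.
move=> cf; rewrite -[leRHS]/(complex.Re (supnorm f)%:C).
rewrite -(circle_integral_cst (supnorm f)%:C).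
apply: ler_normc_circle_integral; first exact: circle_continuous_mul_char.
  exact: circle_continuous_cst.
move=> z cz; rewrite Normc.normcM (circleX _ cz) mulr1.
exact: supnorm_ge.
Qed.

End CircleIntegral.

                                        

(** * De la Vallee Poussin kernel and means *)

(** Dividing the kernel by the central binomial coefficient thus costs only a factor linear in K
    compared with 4^K. The induction rests on (K+1) C(2K+2, K+1) = 2 (2K+1) C(2K, K). *)
Lemma leq_exp4_central_bin (K : nat) : (4 ^ K <= K.*2.+1 * 'C(K.*2, K))%N.
Proof.
elim: K => [|K IH]; first by rewrite bin0.
have rec : (K.+1 * 'C(K.+1.*2, K.+1) = K.*2.+1.*2 * 'C(K.*2, K))%N.
  have K0 : (0 < K.+1 * (K`! * K`!))%N by rewrite !muln_gt0 !fact_gt0.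
  apply/eqP; rewrite -(eqn_pmul2r K0); apply/eqP.
  have h1 := @bin_fact K.+1.*2 K.+1; have h2 := @bin_fact K.*2 K.
  have e1 : (K.+1.*2 - K.+1 = K.+1)%N by lia.
  have e2 : (K.*2 - K = K)%N by lia.
  rewrite e1 in h1; rewrite e2 in h2.
  have {}h1 := h1 ltac:(lia); have {}h2 := h2 ltac:(lia).
  rewrite doubleS !factS -h2 in h1.
  have := h1; rewrite -doubleS; nia.
rewrite -(leq_pmul2l (ltn0Sn K)) expnS.
rewrite mulnCA [(K.+1 * (_ * _))%N]mulnCA rec; nia.
Qed.

Section Kernel.
Variable R : realType.
Implicit Types f g : R[i]^o -> R[i]^o.

(** The sum of s^i for i < k is (1 - s^k) / (1 - s), and each of its k terms is at least s^k. *)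
Lemma mulrn_expr_le (s : R) (k : nat) : 0 <= s -> s < 1 ->
  k%:R * s ^+ k <= (1 - s)^-1.
Proof.
move=> s0 s1; have s1' : 0 < 1 - s by lra.
rewrite -[leRHS]mul1r ler_pdivlMr//.
suff: k%:R * s ^+ k * (1 - s) <= 1 - s ^+ k.
  by have := exprn_ge0 k s0; lra.
elim: k => [|k IH]; first by rewrite expr0 !mul0r subrr.
rewrite exprS -natr1; move: IH (exprn_ge0 k s0) (exprn_ile1 k s0 (ltW s1)).
set u := s ^+ k; set v := k%:R; have v0 : 0 <= v by exact: ler0n.
move=> IH u0 u1.
have -> : (v + 1) * (s * u) * (1 - s) = s * (v * u * (1 - s)) + s * u * (1 - s) by ring.
have : s * (v * u * (1 - s)) <= s * (1 - u) by exact: ler_wpM2l.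
have : s * u * (1 - s) <= 1 - s.
  by rewrite -[leRHS]mul1r ler_wpM2r ?(ltW s1')// mulr_ile1// ltW.
lra.
Qed.

                                                                           
(** The integers from -K to K: the spectrum of the de la Vallee Poussin kernel |1 + z|^(2K) / C(2K,
    K), whose coefficients are the weights below. It is nonnegative and has integral 1, and its
    means are trigonometric polynomials whose spectrum lies in that of the function. *)
Definition vp_freqs (K : nat) : seq int :=
  [seq i%:Z - K%:Z | i <- iota 0 K.*2.+1].

Definition vp_weight (K : nat) (q : int) : R :=
  if q \in vp_freqs K then 'C(K.*2, `|q + K%:Z|)%:R / 'C(K.*2, K)%:R else 0.

Definition vp_kernel (K : nat) (x : R[i]) : R[i]^o -> R[i]^o :=
  fun y => \sum_(q <- vp_freqs K)
    ((vp_weight K q)%:C * x ^ q) * char_fun (- q) y.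

Definition vp_mean (K : nat) f : R[i]^o -> R[i]^o :=
  fun x => \sum_(q <- vp_freqs K)
    ((vp_weight K q)%:C * fourier_coef f q) * char_fun q x.

Lemma vp_freqs_uniq K : uniq (vp_freqs K).
Proof. by rewrite map_inj_uniq ?iota_uniq// => i j /addIr[]. Qed.

Lemma vp_freqs0 K : 0 \in vp_freqs K.
Proof. by apply/mapP; exists K; [rewrite mem_iota; lia|rewrite subrr]. Qed.

Lemma vp_weight0 K : vp_weight K 0 = 1.
Proof.
rewrite /vp_weight vp_freqs0 add0r absz_nat divff// pnatr_eq0 -lt0n bin_gt0.
by rewrite -addnn leq_addr.
Qed.

Lemma vp_kernel_continuous K x : circle_continuous (vp_kernel K x).
Proof.
apply: circle_continuous_sum => q; apply: circle_continuousM.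
  exact: circle_continuous_cst.
exact: circle_continuous_char.
Qed.

Lemma circle_integral_vp_kernel K x : circle R x ->
  circle_integral (vp_kernel K x) = 1.
Proof.
move=> cx; rewrite circle_integral_sum => [|q]; last first.
  apply: circle_continuousM; first exact: circle_continuous_cst.
  exact: circle_continuous_char.
under eq_bigr => q _.
  rewrite circle_integralZ ?circle_integral_char ?oppr_eq0; last first.
    exact: circle_continuous_char.
  over.
rewrite (bigD1_seq 0) ?vp_freqs0 ?vp_freqs_uniq//= mulr1 expr0z mulr1.
rewrite vp_weight0 big1 ?addr0// => q /negPf ->; exact: mulr0.
Qed.

Lemma vp_meanE K f x : circle_continuous f -> circle R x ->
  vp_mean K f x = circle_integral (fun y => f y * vp_kernel K x y).
Proof.
move=> cf cx.
transitivity (circle_integral (fun y => \sum_(q <- vp_freqs K)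
    ((vp_weight K q)%:C * x ^ q) * (f y * char_fun (- q) y))); last first.
  apply: eq_circle_integral => y _; rewrite /vp_kernel mulr_sumr.
  by apply: eq_bigr => q _; rewrite mulrCA.
rewrite circle_integral_sum => [|q]; last first.
  apply: circle_continuousM; first exact: circle_continuous_cst.
  exact: circle_continuous_mul_char.
apply: eq_bigr => q _; rewrite circle_integralZ; last exact: circle_continuous_mul_char.
by rewrite /char_fun mulrAC.
Qed.

Lemma sqr_normc_add1_circle (z : R[i]) : circle R z ->
  (normc (1 + z) ^+ 2)%:C * z = (1 + z) ^+ 2.
Proof.
move=> cz; have := sqr_normc_ReIm z; rewrite cz expr1n.
rewrite sqr_normc_ReIm; case: z {cz} => a b /= ab; simpc.
have E : b ^+ 2 = 1 - a ^+ 2 by rewrite ab; ring.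
by rewrite expr2; simpc; congr (_ +i* _); ring: E.
Qed.

(** With z = x / y on the circle, |1 + z|^2 z = (1 + z)^2. So |1 + z|^(2K) = z^(-K) (1 + z)^(2K),
    and the binomial theorem gives the coefficients. *)
Lemma vp_kernel_circle K x y : circle R x -> circle R y ->
  vp_kernel K x y = (normc (x + y) ^+ K.*2 / 'C(K.*2, K)%:R)%:C.
Proof.
move=> cx cy; have x0 := circle_neq0 cx; have y0 := circle_neq0 cy.
pose z := x / y; have cz : circle R z by apply: circleM => //; exact: circleV.
have z0 := circle_neq0 cz.
have -> : normc (x + y) = normc (1 + z).
  rewrite -(normcZ_circle (1 + z) cy) /z mulrDr mulr1 mulrCA divff// mulr1.
  by rewrite addrC.
set B := 'C(K.*2, K)%:R : R.
have -> : vp_kernel K x y =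
    \sum_(i < K.*2.+1) ('C(K.*2, i)%:R / B)%:C * (z ^+ i * z ^- K).
  rewrite /vp_kernel big_map -(big_mkord xpredT (fun i =>
    ('C(K.*2, i)%:R / B)%:C * (z ^+ i * z ^- K))) /index_iota subn0.
  rewrite big_seq [RHS]big_seq; apply: eq_bigr => i iK.
  rewrite /vp_weight (map_f (fun i : nat => i%:Z - K%:Z) iK) subrK absz_nat -mulrA.
  congr (_ * _).
  rewrite /char_fun -exprz_inv -exprzMl ?unitfE ?invr_eq0//.
  by rewrite expfzDr// exprnN.
have -> : (normc (1 + z) ^+ K.*2 / B)%:C = (1 + z) ^+ K.*2 * (z ^- K * (B^-1)%:C).
  rewrite rmorphM/= mulrA; congr (_ * _).
  apply: (mulIf (expf_neq0 K z0)); rewrite mulfVK ?expf_neq0//.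
  rewrite -!mul2n !exprM -sqr_normc_add1_circle//.
  by rewrite [RHS]exprMn rmorphXn.
rewrite exprDn mulr_suml; apply: eq_bigr => i _.
rewrite expr1n mul1r rmorphM/= rmorph_nat -mulr_natr; ring.
Qed.

Lemma sqr_normc_parallelogram (x y : R[i]) :
  normc (x + y) ^+ 2 = 2 * normc x ^+ 2 + 2 * normc y ^+ 2 - normc (x - y) ^+ 2.
Proof.
by rewrite !sqr_normc_ReIm; case: x => a b; case: y => c d /=; ring.
Qed.

(** By the parallelogram law |x + y|^2 = 4 - |x - y|^2 <= 4 - d^2; [leq_exp4_central_bin] handles
    the denominator. *)
Lemma vp_kernel_far K x y (d : R) : circle R x -> circle R y ->
  0 <= d -> d <= normc (y - x) ->
  complex.Re (vp_kernel K x y) <= K.*2.+1%:R * (1 - d ^+ 2 / 4) ^+ K.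
Proof.
move=> cx cy d0 dxy; rewrite vp_kernel_circle//=.
have B0 : 0 < 'C(K.*2, K)%:R :> R.
  by rewrite ltr0n bin_gt0 -addnn leq_addr.
rewrite ler_pdivrMr//.
have h4 : normc (x + y) ^+ 2 <= 4 - d ^+ 2.
  rewrite sqr_normc_parallelogram cx cy expr1n normc_distC.
  have : d ^+ 2 <= normc (y - x) ^+ 2 by rewrite ler_pXn2r// nnegrE ?normc_ge0.
  lra.
rewrite -mul2n exprM.
have -> : 1 - d ^+ 2 / 4 = (4 - d ^+ 2) / 4 by field.
apply: (@le_trans _ _ ((4 - d ^+ 2) ^+ K)).
  by rewrite lerXn2r// nnegrE ?sqr_ge0// (le_trans _ h4)// sqr_ge0.
rewrite exprMn exprVn.
have p0 : 0 <= (4 - d ^+ 2) ^+ K by rewrite exprn_ge0// (le_trans _ h4)// sqr_ge0.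
rewrite mulrAC mulrC -mulrA ler_peMr//.
rewrite ler_pdivlMl ?exprn_gt0// mulr1 -natrX -natrM ler_nat.
rewrite mul2n; exact: leq_exp4_central_bin.
Qed.

Lemma ler_vp_mean K f x : circle_continuous f -> circle R x ->
  normc (vp_mean K f x) <= supnorm f.
Proof.
move=> cf cx; rewrite vp_meanE//.
have -> : supnorm f =
    complex.Re (circle_integral (fun y => (supnorm f)%:C * vp_kernel K x y)).
  rewrite circle_integralZ; last exact: vp_kernel_continuous.
  by rewrite circle_integral_vp_kernel// mulr1.
apply: ler_normc_circle_integral => [||y cy].
- by apply: circle_continuousM => //; exact: vp_kernel_continuous.
- apply: circle_continuousM; first exact: circle_continuous_cst.
  exact: vp_kernel_continuous.
- rewrite Normc.normcM ReM /= mul0r subr0 vp_kernel_circle// normc_real.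
  rewrite ger0_norm ?divr_ge0 ?exprn_ge0 ?normc_ge0 ?ler0n//=.
  rewrite ler_wpM2r ?supnorm_ge// divr_ge0 ?exprn_ge0 ?normc_ge0 ?ler0n//.
Qed.

(** With s the square root of r, one factor s^K absorbs the linear growth by [mulrn_expr_le], and
    the other tends to 0. *)
Lemma vp_tail_cvg0 (r e : R) : 0 <= r -> r < 1 -> 0 < e ->
  \forall K \near \oo, K.*2.+1%:R * r ^+ K < e.
Proof.
move=> r0 r1 e0; pose s := Num.sqrt r.
have s0 : 0 <= s by exact: sqrtr_ge0.
have s1 : s < 1 by rewrite -sqrtr1 ltr_sqrt.
have rE : r = s * s by rewrite -expr2 sqr_sqrtr.
pose A := 2 * (1 - s)^-1 + 1.
have A0 : 0 < A by rewrite ltr_wpDl// mulr_ge0 ?invr_ge0//; lra.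
have : s ^+ K @[K --> \oo] --> 0 by apply: cvg_expr; rewrite ger0_norm.
move=> /cvgrPdist_lt/(_ (e / A)); rewrite divr_gt0// => /(_ isT).
apply: filterS => K; rewrite sub0r normrN ger0_norm ?exprn_ge0//.
rewrite ltr_pdivlMr// => h; apply: le_lt_trans h.
rewrite rE exprMn mulrCA ler_wpM2l ?exprn_ge0//.
rewrite -natr1 -mul2n natrM mulrDl mul1r /A -mulrA.
apply: lerD; last by rewrite exprn_ile1// ltW.
by rewrite ler_pM2l// mulrn_expr_le.
Qed.

(** The classical approximate identity argument: near x continuity of f bounds the integrand, away
    from x the smallness of the kernel does. *)
Lemma vp_mean_cvg f x (e : R) : circle_continuous f -> circle R x -> 0 < e ->
  \forall K \near \oo, normc (vp_mean K f x - f x) < e.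
Proof.
move=> cf cx e0.
have [|d d0 Hd] := cf x cx (e / 2); first by lra.
pose S := supnorm f; have S0 : 0 <= S := supnorm_ge0 cf.
(* Capping the radius at 1 keeps r in [0, 1), as [vp_tail_cvg0] requires. *)
pose d' := Num.min d 1.
have d'0 : 0 < d' by rewrite lt_min d0 ltr01.
have d'1 : d' <= 1 by rewrite ge_min lexx orbT.
have d'd : d' <= d by rewrite ge_min lexx.
pose r := 1 - d' ^+ 2 / 4.
have /= := @vp_tail_cvg0 r (e / 2 / (2 * S + 1)).
case=> [|||K0 _ HK]; rewrite ?divr_gt0//; [rewrite /r; nra|rewrite /r; nra|lra|].
exists K0 => // K /HK /=; set T := K.*2.+1%:R * r ^+ K => hT.
have cfx : circle_continuous (fun y => f y - f x).
  by apply: circle_continuousD => //; exact: circle_continuous_cst.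
have -> : vp_mean K f x - f x =
    circle_integral (fun y => (f y - f x) * vp_kernel K x y).
  have ck := @vp_kernel_continuous K x.
  rewrite vp_meanE// -[f x in LHS]mulr1 -(circle_integral_vp_kernel K cx).
  rewrite -mulNr -circle_integralZ// -circle_integralD//.
  - by apply: eq_circle_integral => y _; rewrite mulrBl mulNr.
  - exact: circle_continuousM.
  - by apply: circle_continuousM => //; exact: circle_continuous_cst.
pose g y := (e / 2)%:C * vp_kernel K x y + (2 * S * T)%:C.
have cek : circle_continuous (fun y => (e / 2)%:C * vp_kernel K x y).
  apply: circle_continuousM; first exact: circle_continuous_cst.
  exact: vp_kernel_continuous.
apply: (@le_lt_trans _ _ (complex.Re (circle_integral g))); last first.
  rewrite circle_integralD ?circle_integralZ//; last 2 first.
  - exact: vp_kernel_continuous.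
  - exact: circle_continuous_cst.
  rewrite circle_integral_vp_kernel// mulr1 circle_integral_cst /=.
  move: hT; rewrite ltr_pdivlMr; last by lra.
  have T0 : 0 <= T by rewrite mulr_ge0// ?ler0n// exprn_ge0// /r; nra.
  lra.
apply: ler_normc_circle_integral.
- by apply: circle_continuousM => //; exact: vp_kernel_continuous.
- by apply: circle_continuousD => //; exact: circle_continuous_cst.
move=> y cy; rewrite Normc.normcM /g ReD ReM /= mul0r subr0.
have T0 : 0 <= T by rewrite mulr_ge0 ?ler0n// exprn_ge0// /r; nra.
have kE : normc (vp_kernel K x y) = complex.Re (vp_kernel K x y).
  rewrite vp_kernel_circle// normc_real ger0_norm// divr_ge0 ?ler0n//.
  by rewrite exprn_ge0 ?normc_ge0.
have k0 : 0 <= complex.Re (vp_kernel K x y) by rewrite -kE normc_ge0.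
rewrite kE; have [near|far] := ltP (normc (y - x)) d'.
  apply: ler_wpDr; first by apply: mulr_ge0 => //; lra.
  by rewrite ler_wpM2r// ltW// Hd// (lt_le_trans near).
apply: ler_wpDl; first by rewrite mulr_ge0//; lra.
apply: ler_pM => //; first exact: normc_ge0.
  apply: le_trans (ler_normcD _ _) _; rewrite normc_opp.
  by have := supnorm_ge cf cy; have := supnorm_ge cf cx; rewrite -/S; lra.
by apply: vp_kernel_far => //; exact: ltW.
Qed.

Lemma vp_mean_char K q x : vp_mean K (@char_fun R q) x = (vp_weight K q)%:C * x ^ q.
Proof.
rewrite /vp_mean.
have [qK|qK] := boolP (q \in vp_freqs K).
  rewrite (bigD1_seq q) ?vp_freqs_uniq//= fourier_coef_char eqxx mulr1.
  rewrite big1 ?addr0// => p /negPf pq.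
  by rewrite fourier_coef_char eq_sym pq mulr0 mul0r.
rewrite /vp_weight (negPf qK) mul0r big_seq big1// => p pK.
rewrite fourier_coef_char (_ : q == p = false) ?mulr0 ?mul0r//.
by apply: contraNF qK => /eqP ->.
Qed.

(** A character is an eigenvector of the means with eigenvalue the weight, so this is the
    contraction [ler_vp_mean] tested on it at the point 1. The limit of the weights is obtained from
    [vp_mean_cvg] in the same way. *)
Lemma vp_weight_le1 K q : `|vp_weight K q| <= 1.
Proof.
have := ler_vp_mean K (@circle_continuous_char R q) (circle1 R).
rewrite vp_mean_char exp1rz mulr1 normc_real => /le_trans; apply.
by apply: supnorm_le => z cz; rewrite (circleX q cz).
Qed.

Lemma vp_weight_cvg1 q (e : R) : 0 < e ->
  \forall K \near \oo, `|vp_weight K q - 1| < e.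
Proof.
move=> e0; have := vp_mean_cvg (@circle_continuous_char R q) (circle1 R) e0.
apply: filterS => K; rewrite vp_mean_char /char_fun exp1rz mulr1.
by rewrite -(rmorph1 (real_complex R)) -rmorphB normc_real.
Qed.

End Kernel.

                                           

(** * From sums over frequencies to sums over indices *)

Section Enumeration.
Variable n : nat -> int.
Hypothesis n_inj : injective n.

Lemma enum_bound (s : seq int) : exists m0 : nat,
  forall q, q \in s -> range n q -> exists2 j, (j < m0)%N & n j = q.
Proof.
elim: s => [|q s [m0 H]]; first by exists 0%N.
have [[j _ nj]|nq] := pselect (range n q).
  exists (maxn m0 j.+1) => p; rewrite inE => /predU1P[->|/H{}H] rp.
    by exists j; rewrite // leq_max ltnSn orbT.
  by have [i im0 ni] := H rp; exists i; rewrite // leq_max im0.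
by exists m0 => p; rewrite inE => /predU1P[->|/H].
Qed.

Lemma sum_enum (V : zmodType) (s : seq int) (F : int -> V) (m : nat) :
  uniq s ->
  (forall q, q \in s -> range n q -> exists2 j, (j < m)%N & n j = q) ->
  (forall q, q \in s -> ~ range n q -> F q = 0) ->
  \sum_(q <- s) F q = \sum_(0 <= j < m) (if n j \in s then F (n j) else 0).
Proof.
elim: s => [|q s IH] /=.
  by move=> _ _ _; rewrite big_nil big1_seq.
move=> /andP[qs us] Hm HF; rewrite big_cons IH//; last 2 first.
- by move=> p ps; apply: Hm; rewrite inE ps orbT.
- by move=> p ps; apply: HF; rewrite inE ps orbT.
have -> : F q = \sum_(0 <= j < m) (if n j == q then F q else 0).
  have [rq|nq] := pselect (range n q); last first.
    rewrite HF ?inE ?eqxx//.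
    by rewrite big1_seq// => j _; case: ifP.
  have [|j jm nj] := Hm q _ rq; first by rewrite inE eqxx.
  rewrite (bigD1_seq j) ?iota_uniq ?mem_index_iota//= nj eqxx big1 ?addr0// => i ij.
  by rewrite -nj (inj_eq n_inj) (negPf ij).
rewrite -big_split/=; apply: eq_bigr => j _; rewrite inE.
by case: eqVneq => [->|_] /=; rewrite ?(negPf qs) ?addr0 ?add0r.
Qed.

End Enumeration.

(** * Steering lacunary characters and polynomial inequalities *)

Section Lacunary.
Variables (R : realType) (n : nat -> int).
Local Notation a k := (`|n k|%:~R : R).
Local Notation C0 := (4 * pi : R).

Definition growth_from (M : R) (N : nat) : Prop :=
  forall k, (N <= k)%N -> n k != 0 /\ M * a k <= a k.+1.

Lemma growth_from_le M N N' : (N <= N')%N -> growth_from M N -> growth_from M N'.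
Proof. by move=> NN' H k N'k; apply: H; exact: leq_trans N'k. Qed.

Lemma absn_gt0 k : n k != 0 -> 0 < a k.
Proof. by move=> nk; rewrite ltr0z normr_gt0. Qed.

Lemma growth_from_ratio : `|ratio R n k| @[k --> \oo] --> +oo ->
  forall M : R, exists N, growth_from M N.
Proof.
(* The maximum with 1 rules out n k = 0, where the ratio is 0 by convention. *)
move=> /cvgryPge H M; have [N _ HN] := H (Num.max M 1).
exists N => k /HN /=; rewrite ge_max => /andP[h1 h2].
have n0 : n k != 0.
  by apply: contraTneq h2 => nk; rewrite /ratio nk invr0 mulr0 normr0 ler10.
split=> //; move: h1; rewrite /ratio normrM normfV ler_pdivlMr; last first.
  by rewrite normr_gt0 intr_eq0.
by rewrite !intr_norm.
Qed.

                                                                                 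
                                              
(** Hit the target at index N exactly by a nearby root, then steer the later characters starting
    from that root. By the growth hypothesis, the later displacement is too small to spoil the value
    at N by more than 2 C0 / M, and it at most doubles the distance to x. *)
Lemma steer (M : R) : 2 <= M -> forall (d N : nat) (x : R[i]) (w : nat -> R[i]),
  growth_from M N -> circle R x -> (forall k, circle R (w k)) ->
  exists2 y, circle R y & normc (y - x) <= 2 * C0 / a N /\
    forall k, (N <= k < N + d)%N -> normc (y ^ n k - w k) <= 2 * C0 / M.
Proof.
move=> M2; have pi0 := pi_gt0 R.
elim=> [|d IH] N x w gN cx cw.
  exists x => //; split; last by move=> k; lia.
  have /absn_gt0 aN := (gN N (leqnn N)).1.
  by rewrite subrr Normc.normc0 divr_ge0 ?(ltW aN)//; lra.
have [nN0 gr] := gN N (leqnn N).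
have aN := absn_gt0 nN0.
have [y0 cy0 [y0w y0x]] := circle_root_near cx (cw N) nN0.
have [y cy [yy0 Hy]] := IH N.+1 y0 w (growth_from_le (leqnSn N) gN) cy0 cw.
have {}yy0 : normc (y - y0) <= 2 * C0 / (M * a N).
  apply: le_trans yy0 _; rewrite ler_pM2l; last by lra.
  rewrite lef_pV2// posrE; last by rewrite mulr_gt0//; lra.
  by apply: lt_le_trans gr; rewrite mulr_gt0//; lra.
exists y => //; split.
  apply: le_trans (ler_normcB_add _ y0 _) _.
  apply: le_trans (lerD yy0 y0x) _.
  rewrite (_ : 2 * C0 / a N = C0 / a N + C0 / a N); last by ring.
  rewrite lerD2r -mulf_div ler_piMl// ?ler_pdivrMr; try lra.
  by rewrite divr_ge0 ?(ltW aN)//; lra.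
move=> k /andP[]; rewrite leq_eqVlt => /predU1P[<- _|Nk kd]; last first.
  by apply: Hy; rewrite Nk/=; lia.
(* The N-th character moves by at most |n_N| times the displacement 2 C0 / (M |n_N|). *)
rewrite -y0w; apply: le_trans (normc_subX _ cy cy0) _.
apply: le_trans (ler_wpM2l _ yy0) _; first by rewrite ltW.
rewrite [leLHS](_ : _ = 2 * C0 / M)//; field.
by rewrite gt_eqF ?(gt_eqF aN)//; lra.
Qed.

Lemma trig_poly_steer (M : R) (N m : nat) (b : nat -> R[i]) (x u : R[i]) :
  2 <= M -> growth_from M N -> circle R x -> circle R u ->
  exists2 y, circle R y & normc (y - x) <= 2 * C0 / a N /\
    normc (\sum_(N <= k < m) b k * y ^ n k -
           u * (\sum_(N <= k < m) normc (b k))%:C) <=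
      2 * C0 / M * \sum_(N <= k < m) normc (b k).
Proof.
move=> M2 gN cx cu.
(* With this target value, the k-th term becomes u |b k|. *)
have cw k : circle R (u * (phase (b k))^-1).
  by apply: circleM => //; apply: circleV; exact: circle_phase.
have [y cy [yx Hy]] := steer M2 (m - N) gN cx cw.
exists y => //; split=> //.
rewrite rmorph_sum/= mulr_sumr -sumrB mulr_sumr.
apply: le_trans (ler_normc_sum _ _ _) _.
rewrite big_nat_cond [leRHS]big_nat_cond; apply: ler_sum => k /andP[kNm _].
have -> : b k * y ^ n k - u * (normc (b k))%:C =
    b k * (y ^ n k - u * (phase (b k))^-1).
  by rewrite mulrBr; congr (_ - _); rewrite mulrCA -(phaseV (b k)) (mulrC (b k)).
rewrite Normc.normcM mulrC ler_wpM2r ?normc_ge0// Hy//.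
by lia.
Qed.

Lemma sum_absn_le (M : R) N k : 2 <= M -> growth_from M N -> (N <= k)%N ->
  \sum_(N <= j < k) a j <= 2 / M * a k.
Proof.
move=> M2 gN /subnKC <-; elim: (k - N)%N => [|d IH].
  rewrite addn0 big_geq//; apply: mulr_ge0; last by rewrite ler0z normr_ge0.
  by apply: divr_ge0; lra.
rewrite addnS big_nat_recr ?leq_addr//=.
have [n0 gr] := gN (N + d)%N (leq_addr _ _); have a0 := absn_gt0 n0.
have h : 2 * a (N + d) <= 2 / M * a (N + d).+1.
  rewrite mulrAC ler_pdivlMr; last by lra.
  by rewrite -mulrA ler_pM2l// mulrC.
apply: le_trans h; rewrite [leRHS](_ : _ = a (N + d) + a (N + d)); last by ring.
rewrite lerD2r; apply: le_trans IH _.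
rewrite ler_piMl ?(ltW a0)// ler_pdivrMr; lra.
Qed.

Lemma absn_unbounded (M : R) N d : 2 <= M -> growth_from M N ->
  d%:R <= a (N + d).
Proof.
move=> M2 gN; elim: d => [|d IH]; first by rewrite ler0z normr_ge0.
have [n0 gr] := gN (N + d)%N (leq_addr _ _).
have : 1 <= a (N + d).
  by rewrite -[1]/(1%:~R) ler_int -gtz0_ge1 normr_gt0.
rewrite -natr1 addnS; nra.
Qed.

(** The terms from N on form a geometric-like sum bounded by (2 / M) |n_k|. The fixed sum S of the
    first N terms is eventually below the same bound, because |n_k| is unbounded. *)
Lemma sum_absn_small (M : R) N : 2 <= M -> growth_from M N ->
  exists2 N', (N <= N')%N & forall k, (N' <= k)%N ->
    \sum_(0 <= j < k) a j <= 4 / M * a k.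
Proof.
move=> M2 gN; pose S := \sum_(0 <= j < N) a j.
(* Past N + d one has |n_k| >= d > S M / 2, that is S < (2 / M) |n_k|. *)
pose d := (Num.truncn (S * M / 2)).+1.
exists (N + d)%N; first exact: leq_addr.
move=> k dk; have Nk : (N <= k)%N by lia.
rewrite (@big_cat_nat _ _ _ N)//= -/S.
rewrite (_ : 4 / M = 2 / M + 2 / M); last by field; rewrite gt_eqF//; lra.
rewrite mulrDl lerD//; last exact: sum_absn_le M2 gN Nk.
rewrite mulrAC ler_pdivlMr; last by lra.
rewrite -ler_pdivrMl// mulrC.
have : (k - N)%:R <= a (N + (k - N)) by exact: absn_unbounded M2 gN.
rewrite subnKC//; apply: le_trans.
apply: (@le_trans _ _ d%:R); last by rewrite ler_nat; lia.
exact/ltW/truncnS_gt.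
Qed.

(** Steer the tail towards the phase of the head p at x, so that p(x) and the tail add up without
    cancellation. At the steered point y the whole polynomial is bounded by S, and the price is the
    tail error plus the change of p between x and y. *)
Lemma trig_poly_additive (M delta S : R) (k m : nat) (b : nat -> R[i]) (x : R[i]) :
  2 <= M -> growth_from M k -> 0 <= S ->
  \sum_(0 <= j < k) a j <= delta * a k -> (k <= m)%N ->
  (forall z, circle R z -> normc (\sum_(0 <= j < m) b j * z ^ n j) <= S) ->
  (forall j, (j < k)%N -> normc (b j) <= S) ->
  circle R x ->
  normc (\sum_(0 <= j < k) b j * x ^ n j) +
    (1 - 2 * C0 / M) * \sum_(k <= j < m) normc (b j) <= (1 + 2 * C0 * delta) * S.
Proof.
move=> M2 gk S0 hd km HS Hb cx.
have pi0 := pi_gt0 R.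
set p := fun z : R[i] => \sum_(0 <= j < k) b j * z ^ n j.
set T := \sum_(k <= j < m) normc (b j).
have ak := absn_gt0 (gk k (leqnn k)).1.
have [y cy [yx Hy]] := trig_poly_steer m b M2 gk cx (circle_phase (p x)).
have := HS y cy; rewrite (@big_cat_nat _ _ _ k)//= -/(p y).
set h := \sum_(k <= j < m) b j * y ^ n j in Hy * => HSy.
rewrite -/T in Hy.
(* Each head term changes by at most S |n_j| |y - x| with |y - x| <= 2 C0 / |n_k|, and the |n_j| sum
   to at most delta |n_k|. *)
have dp : normc (p y - p x) <= 2 * C0 * delta * S.
  rewrite -sumrB; apply: le_trans (ler_normc_sum _ _ _) _.
  apply: (@le_trans _ _ (\sum_(0 <= j < k) S * (2 * C0 / a k) * a j)).
    rewrite big_nat_cond [leRHS]big_nat_cond.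
    apply: ler_sum => j /andP[/andP[_ jk] _].
    rewrite -mulrBr Normc.normcM -mulrA; apply: ler_pM; rewrite ?normc_ge0 ?Hb//.
    apply: le_trans (normc_subX _ cy cx) _.
    by rewrite mulrC ler_wpM2r// ler0z normr_ge0.
  rewrite -mulr_sumr [leRHS](_ : _ = S * (2 * C0) * delta); last by ring.
  rewrite mulrA -mulrA ler_wpM2l//; first by rewrite mulr_ge0//; lra.
  by rewrite mulrC ler_pdivrMr.
have e1 : normc (p x + phase (p x) * T%:C) = normc (p x) + T.
  have T0 : 0 <= T by apply: sumr_ge0 => j _; exact: normc_ge0.
  rewrite -{1}[p x]phaseM -mulrDr normcZ_circle; last exact: circle_phase.
  by rewrite -rmorphD normc_real ger0_norm// addr_ge0 ?normc_ge0.
have : normc (p x + phase (p x) * T%:C) <=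
    normc (p y + h) + normc (p y - p x) + normc (h - phase (p x) * T%:C).
  have -> : p x + phase (p x) * T%:C =
      (p y + h) - (p y - p x) - (h - phase (p x) * T%:C) by ring.
  apply: le_trans (ler_normcD _ _) _; rewrite normc_opp lerD2r.
  by apply: le_trans (ler_normcD _ _) _; rewrite normc_opp.
rewrite e1 mulrBl mul1r; lra.
Qed.

End Lacunary.

                     

(** * Partial sums of functions with spectrum in E *)

Local Arguments Normc.normc : simpl never.
Local Arguments circle_integral : simpl never.

Section PartialSums.
Variables (R : realType) (n : nat -> int).
Hypothesis n_inj : injective n.
Variable f : R[i]^o -> R[i]^o.
Hypothesis fE : CE (range n) f.
Local Notation a k := (`|n k|%:~R : R).
Local Notation C0 := (4 * pi : R).
Local Notation c j := (fourier_coef f (n j)).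

Lemma CE_continuous : circle_continuous f.
Proof. by case: fE => /circle_continuousP. Qed.

Lemma projE k (x : R[i]) : proj n k f x = \sum_(0 <= j < k) c j * x ^ n j.
Proof. by rewrite /proj big_mkord. Qed.

Lemma proj_continuous k : circle_continuous (proj n k f).
Proof.
apply: circle_continuous_sum => j; apply: circle_continuousM.
  exact: circle_continuous_cst.
exact: circle_continuous_char.
Qed.

Lemma subproj_continuous k : circle_continuous (f \- proj n k f).
Proof.
rewrite (_ : f \- _ = (fun z => f z + (-1) * proj n k f z)); last first.
  by apply/funext => z /=; rewrite mulN1r.
apply: circle_continuousD; first exact: CE_continuous.
by apply: circle_continuousM; [exact: circle_continuous_cst|exact: proj_continuous].
Qed.

(** Frequencies of the mean outside E carry a zero coefficient of f, and indices whose frequency is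
    outside the kernel carry a zero weight. So the mean is a polynomial in the first m characters of
    E, to which the previous inequalities apply. *)
Lemma vp_mean_enum K : exists m0 : nat, forall m (x : R[i]), (m0 <= m)%N ->
  vp_mean K f x = \sum_(0 <= j < m) ((vp_weight R K (n j))%:C * c j) * x ^ n j.
Proof.
have [m0 H] := enum_bound n (vp_freqs K).
exists m0 => m x m0m; rewrite /vp_mean.
rewrite (sum_enum n_inj (m := m)) ?vp_freqs_uniq//; first last.
- by move=> q _ nq; rewrite (fE.2 q nq) mulr0 mul0r.
- by move=> q /H{}H /H[j jm0 nj]; exists j => //; exact: leq_trans m0m.
apply: eq_bigr => j _; case: ifP => // njK.
by rewrite {1}/vp_weight njK !mul0r.
Qed.

Lemma vp_weights_near1 k (e : R) : 0 < e -> \forall K \near \oo,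
  forall j, (j < k)%N -> `|vp_weight R K (n j) - 1| < e.
Proof.
move=> e0; elim: k => [|k IH]; first by near=> K.
have := vp_weight_cvg1 (n k) e0.
apply: filterS2 IH => K H1 H2 j; rewrite ltnS leq_eqVlt => /predU1P[->//|].
exact: H1.
Unshelve. all: by end_near.
Qed.

Lemma normc_weightM (v : R) (z : R[i]) : normc (v%:C * z) = `|v| * normc z.
Proof. by rewrite Normc.normcM normc_real. Qed.

(** [trig_poly_additive] applied to a mean of f, with S the norm of f: the means are bounded by S,
    and so are their coefficients. Letting the weights of the first m coefficients tend to 1 gives
    the inequality for f itself. *)
Lemma proj_additive (M delta : R) (k m : nat) (x : R[i]) :
  2 <= M -> growth_from n M k -> \sum_(0 <= j < k) a j <= delta * a k ->
  0 <= 1 - 2 * C0 / M -> circle R x ->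
  normc (proj n k f x) + (1 - 2 * C0 / M) * \sum_(k <= j < m) normc (c j) <=
    (1 + 2 * C0 * delta) * supnorm f.
Proof.
move=> M2 gk hd gam0 cx; wlog km : m / (k <= m)%N => [H|].
  have [/H//|mk] := leqP k m.
  by have := H k (leqnn k); rewrite !big_geq// ltnW.
set gam := 1 - 2 * C0 / M in gam0 *.
have gam1 : gam <= 1.
  have pi0 := pi_gt0 R.
  by rewrite /gam lerBlDr lerDl divr_ge0//; lra.
have cf := CE_continuous.
pose A := \sum_(0 <= j < m) normc (c j).
have A0 : 0 <= A by apply: sumr_ge0 => j _; exact: normc_ge0.
apply/ler_addgt0Pr => e e0.
(* With weights this close to 1, replacing c j by b j for j < m costs at most e A / (A + 1) <= e in
   all; the 1 avoids a zero denominator. *)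
have e'0 : 0 < e / (A + 1) by rewrite divr_gt0//; lra.
have [K _ /(_ K (leqnn K)) HK] := vp_weights_near1 m e'0.
have [m0 Hm0] := vp_mean_enum K.
have [m1 m0m1 mm1] : exists2 m1, (m0 <= m1)%N & (m <= m1)%N.
  by exists (maxn m0 m); rewrite ?leq_maxl ?leq_maxr.
pose b j : R[i] := (vp_weight R K (n j))%:C * c j.
have km1 : (k <= m1)%N := leq_trans km mm1.
have bc j : normc (b j) <= normc (c j).
  by rewrite normc_weightM ler_piMl ?normc_ge0// vp_weight_le1.
have bc' j : (j < m)%N -> normc (c j - b j) <= e / (A + 1) * normc (c j).
  move=> jm; rewrite -{1}[c j]mul1r -mulrBl -(rmorph1 (real_complex R)) -rmorphB.
  by rewrite normc_weightM distrC ler_wpM2r ?normc_ge0// ltW// HK.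
have H : normc (\sum_(0 <= j < k) b j * x ^ n j) +
    gam * \sum_(k <= j < m1) normc (b j) <= (1 + 2 * C0 * delta) * supnorm f.
  apply: trig_poly_additive => // [|z cz|j _]; first exact: supnorm_ge0.
    by rewrite -Hm0//; exact: ler_vp_mean.
  by apply: le_trans (bc j) _; exact: ler_fourier_coef.
apply: le_trans (lerD H (lexx e)).
have h1 : normc (proj n k f x) <= normc (\sum_(0 <= j < k) b j * x ^ n j) +
    \sum_(0 <= j < k) e / (A + 1) * normc (c j).
  rewrite projE -lerBlDl; apply: le_trans.
    rewrite -(normc_opp (\sum_(0 <= j < k) b j * _)); exact: lerB_normcD.
  rewrite -sumrB; apply: le_trans (ler_normc_sum _ _ _) _.
  rewrite big_nat_cond [leRHS]big_nat_cond; apply: ler_sum => j /andP[/andP[_ jk] _].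
  rewrite -mulrBl Normc.normcM (circleX _ cx) mulr1 bc'//.
  exact: leq_trans km.
have h2 : \sum_(k <= j < m) normc (c j) <= \sum_(k <= j < m1) normc (b j) +
    \sum_(k <= j < m) e / (A + 1) * normc (c j).
  have -> : \sum_(k <= j < m1) normc (b j) =
      \sum_(k <= j < m) normc (b j) + \sum_(m <= j < m1) normc (b j).
    exact: big_cat_nat.
  apply: (@le_trans _ _ (\sum_(k <= j < m) normc (b j) +
      \sum_(k <= j < m) e / (A + 1) * normc (c j))); last first.
    by rewrite lerD2r lerDl; apply: sumr_ge0 => j _; exact: normc_ge0.
  rewrite -big_split/= big_nat_cond [leRHS]big_nat_cond.
  apply: ler_sum => j /andP[/andP[_ jm] _].
  rewrite -lerBlDl; apply: le_trans (bc' j jm).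
  by rewrite -(normc_opp (b j)); exact: lerB_normcD.
have h3 : \sum_(0 <= j < k) e / (A + 1) * normc (c j) +
   \sum_(k <= j < m) e / (A + 1) * normc (c j) <= e.
  rewrite -(@big_cat_nat _ _ _ k 0%N m)//=.
  rewrite -mulr_sumr -/A mulrAC ler_pdivrMr; last by lra.
  rewrite ler_pM2l//; lra.
have p0 : 0 <= \sum_(k <= j < m) e / (A + 1) * normc (c j).
  by apply: sumr_ge0 => j _; rewrite mulr_ge0 ?normc_ge0// ltW.
have := ler_wpM2l gam0 h2; rewrite mulrDr => {}h2.
have := ler_wpM2r p0 gam1; rewrite mul1r => h4.
lra.
Qed.

(** At x, f is the limit of its means. Their terms below k tend to the partial sum, and their terms
    from k on are bounded by those of the absolute series since the weights are at most 1. *)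
Lemma subproj_le (B : R) (k : nat) (x : R[i]) : circle R x ->
  (forall m, \sum_(k <= j < m) normc (c j) <= B) ->
  normc (f x - proj n k f x) <= B.
Proof.
move=> cx HB; have cf := CE_continuous.
pose A := \sum_(0 <= j < k) normc (c j).
have A0 : 0 <= A by apply: sumr_ge0 => j _; exact: normc_ge0.
apply/ler_addgt0Pr => e e0.
have e20 : 0 < e / 2 by lra.
have [K [HK1 HK2]] : exists K,
    (forall j, (j < k)%N -> `|vp_weight R K (n j) - 1| < e / 2 / (A + 1)) /\
    normc (vp_mean K f x - f x) < e / 2.
  have e'2 : 0 < e / 2 / (A + 1) by rewrite divr_gt0//; lra.
  have [K1 _ H1] := vp_weights_near1 k e'2.
  have [K2 _ H2] := vp_mean_cvg cf cx e20.
  exists (maxn K1 K2); split.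
    by apply: H1; exact: leq_maxl.
  by apply: H2; exact: leq_maxr.
have [m0 Hm0] := vp_mean_enum K.
have [m1 m0m1 km1] : exists2 m1, (m0 <= m1)%N & (k <= m1)%N.
  by exists (maxn m0 k); rewrite ?leq_maxl ?leq_maxr.
have := Hm0 m1 x m0m1.
rewrite (@big_cat_nat _ _ _ k 0%N m1)//=.
set P := \sum_(0 <= j < k) _; set Q := \sum_(k <= j < m1) _ => VE.
have hQ : normc Q <= B.
  apply: le_trans (HB m1); apply: le_trans (ler_normc_sum _ _ _) _.
  apply: ler_sum => j _; rewrite Normc.normcM (circleX _ cx) mulr1 normc_weightM.
  by rewrite ler_piMl ?normc_ge0// vp_weight_le1.
have hP : normc (P - proj n k f x) <= e / 2.
  rewrite projE -sumrB; apply: le_trans (ler_normc_sum _ _ _) _.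
  apply: (@le_trans _ _ (\sum_(0 <= j < k) e / 2 / (A + 1) * normc (c j))).
    rewrite big_nat_cond [leRHS]big_nat_cond.
    apply: ler_sum => j /andP[/andP[_ jk] _].
    rewrite -mulrBl Normc.normcM (circleX _ cx) mulr1.
    rewrite -{2}[c j]mul1r -mulrBl -(rmorph1 (real_complex R)) -rmorphB.
    by rewrite normc_weightM ler_wpM2r ?normc_ge0// ltW// HK1.
  rewrite -mulr_sumr -/A mulrAC ler_pdivrMr; last by lra.
  rewrite ler_pM2l//; lra.
have -> : f x - proj n k f x =
    - (vp_mean K f x - f x) + (P - proj n k f x) + Q :> R[i].
  by rewrite VE; ring.
apply: le_trans (ler_normcD _ _) _.
have := ler_normcD (- (vp_mean K f x - f x)) (P - proj n k f x).
rewrite normc_opp; lra.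
Qed.

Lemma subproj_additive (M delta : R) (k : nat) :
  2 <= M -> growth_from n M k -> \sum_(0 <= j < k) a j <= delta * a k ->
  0 < 1 - 2 * C0 / M ->
  supnorm (proj n k f) + (1 - 2 * C0 / M) * supnorm (f \- proj n k f) <=
    (1 + 2 * C0 * delta) * supnorm f.
Proof.
(* The two suprema are taken at independent points x and z: the tail is controlled by the sum of the
   |c j|, which involves no point. *)
move=> M2 gk hd gam0; rewrite -lerBrDr; apply: supnorm_le => x cx.
rewrite lerBrDr -lerBrDl mulrC -ler_pdivlMr//.
apply: supnorm_le => z cz; apply: subproj_le => // m.
rewrite ler_pdivlMr// mulrC lerBrDl.
by apply: proj_additive => //; exact: ltW.
Qed.

Lemma ler_supnorm_subproj k :
  supnorm f <= supnorm (f \- proj n k f) + supnorm (proj n k f).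
Proof.
apply: supnorm_le => z cz.
have := ler_normcD (f z - proj n k f z) (proj n k f z); rewrite subrK.
have := supnorm_ge (subproj_continuous k) cz.
by have := supnorm_ge (proj_continuous k) cz; rewrite /=; lra.
Qed.

(** The coefficients are absolutely summable by [proj_additive], so the tails of their absolute
    series tend to 0, and [subproj_le] turns this into uniform convergence. *)
Lemma proj_cvg (M : R) (k0 : nat) : 2 <= M -> growth_from n M k0 ->
  0 < 1 - 2 * C0 / M -> supnorm (f \- proj n k f) @[k --> \oo] --> (0 : R).
Proof.
move=> M2 gk gam0.
have a0 := absn_gt0 R (gk k0 (leqnn k0)).1.
pose U := (1 + 2 * C0 * (\sum_(0 <= j < k0) a j / a k0)) * supnorm f /
  (1 - 2 * C0 / M).
have HU m : \sum_(k0 <= j < m) normc (c j) <= U.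
  rewrite ler_pdivlMr// mulrC.
  have := @proj_additive M (\sum_(0 <= j < k0) a j / a k0) k0 m 1 M2 gk.
  rewrite -mulr_suml divfK ?gt_eqF// lexx => /(_ isT (ltW gam0) (circle1 R)).
  by apply: le_trans; rewrite lerDr normc_ge0.
apply/cvgrPdist_le => e e0.
pose T := [set \sum_(k0 <= j < m) normc (c j) | m in [set: nat]].
have supT : has_sup T.
  split; first by exists (\sum_(k0 <= j < 0) normc (c j)), 0%N.
  by exists U => _ [m _ <-].
have [_ [m1 _ <-] Hm1] := sup_adherent e0 supT.
exists (maxn k0 m1) => // k /=; rewrite geq_max => /andP[k0k m1k].
rewrite sub0r normrN ger0_norm ?(supnorm_ge0 (subproj_continuous k))//.
apply: supnorm_le => x cx; apply: subproj_le => // m.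
have [mk|km] := leqP m k; first by rewrite big_geq// ltW.
have : \sum_(k0 <= j < m) normc (c j) <= sup T.
  by apply: sup_upper_bound => //; exists m.
rewrite (@big_cat_nat _ _ _ k k0 m)//=; last exact: ltnW.
have : \sum_(k0 <= j < m1) normc (c j) <= \sum_(k0 <= j < k) normc (c j).
  have [m1k0|k0m1] := leqP m1 k0.
    by rewrite big_geq// sumr_ge0// => j _; exact: normc_ge0.
  rewrite [leRHS](@big_cat_nat _ _ _ m1)//=; last exact: ltnW.
  by rewrite lerDl sumr_ge0// => j _; exact: normc_ge0.
lra.
Qed.

End PartialSums.

(** * The direct implication *)

Section Forward.
Variables (R : realType) (n : nat -> int).
Hypothesis n_inj : injective n.
Local Notation C0 := (4 * pi : R).
Hypothesis ratio_infty : `|ratio R n k| @[k --> \oo] --> +oo.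

(** With c = C0 / M, the last inequality reads (10 + 2 e) c <= e; the choice u = e / (20 + 2 e)
    leaves room to spare and also makes 2 c < 1. *)
Lemma large_growth (e : R) : 0 < e -> exists M,
  [/\ 2 <= M, 0 < 1 - 2 * C0 / M &
      1 + 2 * C0 * (4 / M) <= (1 + e) * (1 - 2 * C0 / M)].
Proof.
move=> e0; have pi0 := pi_gt0 R.
pose u := e / (20 + 2 * e) ; pose M := 2 + C0 / u.
have u0 : 0 < u by rewrite divr_gt0//; lra.
have M2 : 2 <= M by rewrite /M lerDl divr_ge0//; lra.
have CM : C0 / M <= u.
  rewrite ler_pdivrMr; last by lra.
  have uC : C0 / u * u = C0 by rewrite divfK// gt_eqF.
  have -> : u * M = 2 * u + C0 by rewrite /M -[X in _ = _ + X]uC; ring.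
  lra.
have CM0 : 0 < C0 / M by rewrite divr_gt0//; lra.
have ue : (20 + 2 * e) * u = e by rewrite mulrC divfK// gt_eqF//; lra.
exists M; split=> //.
- by rewrite -mulrA; nra.
- have -> : 2 * C0 * (4 / M) = 8 * (C0 / M) by ring.
  have -> : 2 * C0 / M = 2 * (C0 / M) by ring.
  nra.
Qed.

Lemma realizes_l1map_lacunary : realizes_l1map R n.
Proof.
split=> [f fE|e e0].
  have [M [M2 gam0 _]] := large_growth (@ltr01 R).
  have [N gN] := growth_from_ratio ratio_infty M.
  exact: (proj_cvg n_inj fE M2 gN gam0).
have e20 : 0 < e / 2 by lra.
have [M [M2 gam0 HM]] := large_growth e20.
have [N gN] := growth_from_ratio ratio_infty M.
have [N' NN' HN'] := sum_absn_small M2 gN.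
exists N' => // k /= N'k f fE f1.
have gk : growth_from n M k by apply: growth_from_le gN; exact: leq_trans N'k.
have := subproj_additive n_inj fE M2 gk (HN' k N'k) gam0.
have := ler_supnorm_subproj fE k.
have := supnorm_ge0 (proj_continuous n f k).
have := supnorm_ge0 (subproj_continuous fE k).
rewrite f1 mulr1.
set P := supnorm (proj n k f); set Q := supnorm (f \- proj n k f).
move=> Q0 P0 low up; rewrite ger0_norm; last by lra.
have pi0 := pi_gt0 R.
have g1 : 2 * C0 / M >= 0 by rewrite divr_ge0//; lra.
move: HM gam0 up; set gam := 1 - 2 * C0 / M => HM gam0 up.
have gam1 : gam <= 1 by rewrite /gam; lra.
(* As gam <= 1, gam (Q + P) <= P + gam Q, which the additive inequality bounds by 1 + 8 C0 / M;
   [large_growth] was tuned so that this is at most gam (1 + e / 2). *)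
have : gam * (Q + P) <= gam * (1 + e / 2).
  have : gam * P <= P by rewrite ler_piMl.
  by rewrite mulrDr; lra.
by rewrite ler_pM2l//; lra.
Qed.

Lemma sidon_lacunary : sidon_asymptotically_1 R (range n).
Proof.
move=> e e0.
have e20 : 0 < e / 2 by lra.
have [M [M2 gam0 HM]] := large_growth e20.
have [N gN] := growth_from_ratio ratio_infty M.
have pi0 := pi_gt0 R.
exists (n @` `I_N); split; first exact/finite_image/finite_II.
apply: (@le_lt_trans _ _ (1 + e / 2)%:E); last by rewrite lte_fin; lra.
apply: ereal_inf_lbound; exists (1 + e / 2) => //= G b GE.
have Gn q : q \in G -> range n q by move=> /GE[].
have GN j : (j < N)%N -> n j \notin G.
  by move=> jN; apply/negP => /GE[_]; apply; exists j.
have [m Hm] := enum_bound n G.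
pose b' j := if n j \in G then b (n j) else 0.
(* If m <= N, every element of G would have an index below N, which is excluded: G is empty. *)
have [mN|Nm] := leqP m N.
  rewrite big_seq big1 ?mulr_ge0//; first by lra.
    apply: supnorm_ge0; apply: circle_continuous_sum => q.
    apply: circle_continuousM; first exact: circle_continuous_cst.
    exact: circle_continuous_char.
  move=> q qG; have [j jm nj] := Hm q qG (Gn q qG).
  by have := GN j (leq_trans jm mN); rewrite nj qG.
have enumN (V : zmodType) (F : int -> V) :
    \sum_(q <- G) F q = \sum_(N <= j < m) (if n j \in G then F (n j) else 0).
  rewrite (sum_enum n_inj (fset_uniq G) Hm) => [|q qG]; last by case; exact: Gn.
  rewrite (@big_cat_nat _ _ _ N)//=; last exact: ltnW.
  by rewrite big_nat_cond big1 ?add0r// => j /andP[/andP[_ /GN/negPf->]].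
have [y cy [_ Hy]] := trig_poly_steer m b' M2 gN (circle1 R) (circle1 R).
have := @supnorm_ge R (fun z => \sum_(q <- G) b q * char_fun q z) y _ cy.
have cG : circle_continuous (fun z => \sum_(q <- G) b q * @char_fun R q z).
  apply: circle_continuous_sum => q; apply: circle_continuousM.
    exact: circle_continuous_cst.
  exact: circle_continuous_char.
move=> /(_ cG); set S := supnorm _.
rewrite !enumN.
have -> : \sum_(N <= j < m) (if n j \in G then normc (b (n j)) else 0) =
    \sum_(N <= j < m) normc (b' j).
  by apply: eq_bigr => j _; rewrite /b'; case: ifP => //; rewrite Normc.normc0.
have -> : \sum_(N <= j < m) (if n j \in G then b (n j) * char_fun (n j) y else 0) =
    \sum_(N <= j < m) b' j * y ^ n j.
  by apply: eq_bigr => j _; rewrite /b'; case: ifP => //; rewrite mul0r.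
move: Hy; set T := \sum_(N <= j < m) normc (b' j).
set h := \sum_(N <= j < m) b' j * y ^ n j; rewrite mul1r => Hy hS.
have T0 : 0 <= T by apply: sumr_ge0 => j _; exact: normc_ge0.
have := lerB_normcD T%:C (h - T%:C); rewrite (addrC T%:C) subrK normc_real ger0_norm//.
set gam := 1 - 2 * C0 / M in HM gam0.
move=> hT.
have gT : gam * T <= S by rewrite /gam mulrBl mul1r; lra.
have : 1 * T <= (1 + e / 2) * gam * T.
  rewrite ler_wpM2r//; apply: le_trans HM; rewrite lerDl.
  by rewrite mulr_ge0// ?divr_ge0//; lra.
rewrite mul1r -mulrA => /le_trans; apply.
by rewrite ler_wpM2l//; lra.
Qed.

End Forward.

                       

(** * The converse for integer ratios *)

Lemma frequently_pigeonhole (T : eqType) (r : nat -> T) (L : seq T) :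
  (forall N, exists2 k, (N <= k)%N & r k \in L) ->
  exists s, forall N, exists2 k, (N <= k)%N & r k = s.
Proof.
elim: L => [|x L IH] H; first by have [k] := H 0%N.
have [|/existsNP[N0 HN0]] := pselect (forall N, exists2 k, (N <= k)%N & r k = x).
  by exists x.
apply: IH => N; have [k] := H (maxn N N0).
rewrite geq_max inE => /andP[Nk N0k] /orP[/eqP rk|rk]; last by exists k.
by exfalso; apply: HN0; exists k.
Qed.

Lemma mem_int_interval (B : nat) (q : int) :
  `|q| <= B%:Z -> q \in [seq i%:Z - B%:Z | i <- iota 0 B.*2.+1].
Proof.
move=> qB; apply/mapP; exists `|(q + B%:Z)%R|%N; first by rewrite mem_iota; lia.
lia.
Qed.

Section Converse.
Variable R : realType.

(** The variance identity: the squared modulus of the sum plus the sum of squared pairwise distances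
    is 4 times the sum of squared moduli. A sum of modulus near 4 thus forces all four terms to be
    close. *)
Lemma sqr_normc_sum4 (z1 z2 z3 z4 : R[i]) :
  circle R z1 -> circle R z2 -> circle R z3 -> circle R z4 ->
  normc (z1 + z2 + z3 + z4) ^+ 2 =
  16 - (normc (z1 - z2) ^+ 2 + normc (z1 - z3) ^+ 2 + normc (z1 - z4) ^+ 2 +
        normc (z2 - z3) ^+ 2 + normc (z2 - z4) ^+ 2 + normc (z3 - z4) ^+ 2).
Proof.
move=> c1 c2 c3 c4.
have -> : (16 : R) = 4 * (normc z1 ^+ 2 + normc z2 ^+ 2 + normc z3 ^+ 2 + normc z4 ^+ 2).
  by rewrite c1 c2 c3 c4; ring.
rewrite !sqr_normc_ReIm.
by case: z1 z2 z3 z4 {c1 c2 c3 c4} => [? ?] [? ?] [? ?] [? ?] /=; ring.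
Qed.

                                                              
                                                    
(** Three of the distances between the four terms, namely those between u and u^s, u and w v, w v
    and w v^s, cannot all be small since w^(s-1) = -1. The bound depends on s only and holds for all
    u and v on the circle. *)
Lemma normc_sum4_lt (s : int) (w u v : R[i]) (eta : R) :
  eta = 2 / (`|s - 1|%:~R + 2) ->
  circle R w -> w ^ (s - 1) = -1 -> circle R u -> circle R v ->
  normc (u + u ^ s + w * v + w * v ^ s) <= 4 - eta ^+ 2 / 8.
Proof.
move=> etaE cw ws cu cv; set P : R := `|s - 1|%:~R in etaE.
have P0 : 0 <= P by rewrite ler0z normr_ge0.
have eta0 : 0 < eta by rewrite etaE divr_gt0//; lra.
have etaP : eta * (P + 2) = 2 by rewrite etaE divfK// gt_eqF//; lra.
have eta1 : eta <= 1 by nra.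
have expS x : circle R x -> x ^ s = x * x ^ (s - 1).
  by move=> cx; rewrite -[in LHS](subrK 1 s) expfzDr ?circle_neq0// expr1z mulrC.
have d1 : normc (u - u ^ s) = normc (1 - u ^ (s - 1)).
  by rewrite (expS u)// -{1}[u]mulr1 -mulrBr normcZ_circle.
have d2 : normc (w * v - w * v ^ s) = normc (1 - v ^ (s - 1)).
  rewrite -mulrBr normcZ_circle//.
  by rewrite (expS v)// -{1}[v]mulr1 -mulrBr normcZ_circle.
have d3 : normc (u ^ (s - 1) + v ^ (s - 1)) <= P * normc (u - w * v).
  have := normc_subX (s - 1) cu (circleM cw cv).
  by rewrite exprzMl ?unitfE ?circle_neq0// ws mulN1r opprK.
(* Write 2 as (1 - u^(s-1)) + (u^(s-1) + v^(s-1)) + (1 - v^(s-1)); the middle term is u^(s-1) - (w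
   v)^(s-1). Since eta (P + 2) = 2, the three distances cannot all be below eta. *)
have sum2 : 2 <= normc (u - u ^ s) + P * normc (u - w * v) +
                 normc (w * v - w * v ^ s).
  rewrite d1 d2; apply: le_trans (lerD (lerD (lexx _) d3) (lexx _)).
  have {1}-> : (2 : R) = normc ((1 - u ^ (s - 1)) + (u ^ (s - 1) + v ^ (s - 1)) +
      (1 - v ^ (s - 1))).
    rewrite (_ : _ + _ = 2%:R%:C); last by rewrite rmorph_nat; ring.
    by rewrite normc_real ger0_norm.
  apply: le_trans (ler_normcD _ _) _; rewrite lerD2r; exact: ler_normcD.
have key : eta ^+ 2 <= normc (u - u ^ s) ^+ 2 + normc (u - w * v) ^+ 2 +
    normc (w * v - w * v ^ s) ^+ 2.
  move: (normc_ge0 (u - u ^ s)) (normc_ge0 (u - w * v))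
    (normc_ge0 (w * v - w * v ^ s)) sum2.
  move: (normc (u - u ^ s)) (normc (u - w * v)) (normc (w * v - w * v ^ s)).
  move=> x y z x0 y0 z0 h.
  have sq (t : R) : eta <= t -> eta ^+ 2 <= t ^+ 2.
    by move=> et; rewrite ler_pXn2r// nnegrE; lra.
  have [/sq xe|xe] := leP eta x; first by have := sqr_ge0 y; have := sqr_ge0 z; lra.
  have [/sq ye|ye] := leP eta y; first by have := sqr_ge0 x; have := sqr_ge0 z; lra.
  have [/sq ze|ze] := leP eta z; first by have := sqr_ge0 x; have := sqr_ge0 y; lra.
  have : P * y <= P * eta by rewrite ler_wpM2l// ltW.
  lra.
have c2 := circleX s cu; have c3 := circleM cw cv.
have c4 := circleM cw (circleX s cv).
have h := sqr_normc_sum4 cu c2 c3 c4.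
have : normc (u + u ^ s + w * v + w * v ^ s) ^+ 2 <= (4 - eta ^+ 2 / 8) ^+ 2.
  rewrite h.
  have := sqr_ge0 (normc (u - w * v ^ s)).
  have := sqr_ge0 (normc (u ^ s - w * v)).
  have := sqr_ge0 (normc (u ^ s - w * v ^ s)).
  have := sqr_ge0 (eta ^+ 2 / 8).
  have -> : (4 - eta ^+ 2 / 8) ^+ 2 = 16 - eta ^+ 2 + (eta ^+ 2 / 8) ^+ 2 by field.
  lra.
have e2 : eta ^+ 2 <= 1 by rewrite exprn_ile1// ltW.
by rewrite ler_pXn2r// nnegrE ?normc_ge0//; lra.
Qed.

Variable n : nat -> int.
Hypothesis n_inj : injective n.

(** Otherwise infinitely many ratios lie in a bounded set of integers, so one value s recurs. Two
    such pairs beyond the exceptional set F give the four-term polynomial of [normc_sum4_lt],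
    incompatible with a Sidon constant close to 1. *)
Lemma ratio_int_infty : (forall k : nat, ratio R n k \is a Num.int) ->
  sidon_asymptotically_1 R (range n) -> `|ratio R n k| @[k --> \oo] --> +oo.
Proof.
move=> nint sidon; apply/cvgryPge => A; apply: contrapT => nA.
have {nA} freq N : exists2 k, (N <= k)%N &
    Num.floor (ratio R n k) \in
      [seq i%:Z - (Num.truncn A).+1%:Z | i <- iota 0 (Num.truncn A).+1.*2.+1].
  apply: contrapT => nk; apply: nA; exists N => // k /= Nk.
  rewrite leNgt; apply/negP => kA; apply: nk; exists k => //.
  apply: mem_int_interval; rewrite -(@ler_int R) intr_norm floorK ?nint//.
  by rewrite ltW// (lt_trans kA)// truncnS_gt.
have [s {}freq] := frequently_pigeonhole freq.
(* Beyond the only index where n may vanish, a ratio s really means n k.+1 = s * n k, not the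
   conventional quotient by 0. *)
have [N0 HN0] : exists N0, forall k, (N0 <= k)%N -> n k != 0.
  have [[k0 nk0]|H] := pselect (exists k, n k = 0).
    exists k0.+1 => k k0k; apply/eqP => nk.
    by have := n_inj (etrans nk (esym nk0)); lia.
  by exists 0%N => k _; apply/eqP => nk; apply: H; exists k.
have step k : (N0 <= k)%N -> Num.floor (ratio R n k) = s -> n k.+1 = s * n k.
  move=> /HN0 nk fs; apply: (@intr_inj R).
  by rewrite intrM -fs floorK ?nint// /ratio divfK// intr_eq0.
have s1 : s != 1.
  have [k Nk fs] := freq N0; apply/eqP => s1.
  have := step k Nk fs; rewrite s1 mul1r => /n_inj; lia.
pose eta : R := 2 / (`|s - 1|%:~R + 2).
have eta0 : 0 < eta.
  by rewrite divr_gt0// ltr_wpDl// ler0z normr_ge0.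
pose w := expi (pi / (s - 1)%:~R : R).
have ws : w ^ (s - 1) = -1.
  rewrite expiX mulrC divfK ?intr_eq0 ?subr_eq0//.
  by rewrite /expi cospi sinpi -(rmorphN1 (real_complex R)).
have cw : circle R w := expi_circle _.
(* With y = eta^2, (1 + y / 64) (4 - y / 8) = 4 - y / 16 - y^2 / 512 < 4, whereas the four
   coefficients have moduli summing to 4. *)
have eps0 : 0 < eta ^+ 2 / 64 by rewrite divr_gt0// exprn_gt0.
have [F [finF]] := sidon _ eps0.
move=> /ereal_inf_lt[_ [C HC <-]]; rewrite lte_fin => Clt.
have [L FL] : exists L : seq int, F = [set` L] by apply/finite_seqP.
have [m Hm] := enum_bound n L.
have nF k : (m <= k)%N -> ~ F (n k).
  rewrite FL => mk nk; have [|j jm nj] := Hm (n k) nk; first by exists k.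
  by have := n_inj nj; lia.
have [j] := freq (maxn N0 m); rewrite geq_max => /andP[N0j mj] fj.
(* Starting at j + 2 makes j, j + 1, k and k + 1 distinct. *)
have [k jk fk] := freq j.+2.
have N0k : (N0 <= k)%N by apply: leq_trans N0j _; apply: leq_trans jk; lia.
have nj := step j N0j fj; have nk := step k N0k fk.
pose l := [:: n j; n j.+1; n k; n k.+1].
pose G := [fset q in l]%fset.
pose b (q : int) : R[i] := if q \in [:: n j; n j.+1] then 1 else w.
have ul : uniq l.
  rewrite /l (_ : [:: _; _; _; _] = map n [:: j; j.+1; k; k.+1])//.
  by rewrite map_inj_uniq//= !inE; lia.
have Gl (V : zmodType) (H : int -> V) :
    \sum_(q <- G) H q = H (n j) + H (n j.+1) + H (n k) + H (n k.+1).
  rewrite (perm_big l)/=; last first.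
    by apply: uniq_perm; rewrite ?fset_uniq// => q; rewrite !inE orbF.
  by rewrite !big_cons big_nil addr0 !addrA.
have bj : b (n j) = 1 by rewrite /b !inE eqxx.
have bj1 : b (n j.+1) = 1 by rewrite /b !inE eqxx orbT.
have bk : b (n k) = w.
  by rewrite /b !inE !(inj_eq n_inj) (_ : _ || _ = false)//; lia.
have bk1 : b (n k.+1) = w.
  by rewrite /b !inE !(inj_eq n_inj) (_ : _ || _ = false)//; lia.
have GF : [set` G] `<=` range n `\` F.
  by move=> q /=; rewrite !inE orbF => /or4P[] /eqP ->; split;
    try (by eexists); apply: nF; lia.
have := HC G b GF.
rewrite Gl bj bj1 bk bk1 Normc.normc1 cw.
set S := supnorm _ => hC.
have hS : S <= 4 - eta ^+ 2 / 8.
  apply: supnorm_le => z cz; rewrite Gl bj bj1 bk bk1 /char_fun nj nk !mul1r.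
  (* The polynomial is now expressed through u = z^(n j) and v = z^(n k). *)
  rewrite ![s * _]mulrC -!exprz_exp.
  exact: (normc_sum4_lt (erefl eta) cw ws (circleX _ cz) (circleX _ cz)).
have S0 : 0 <= S.
  apply: supnorm_ge0; apply: circle_continuous_sum => q.
  by apply: circle_continuousM;
    [exact: circle_continuous_cst|exact: circle_continuous_char].
have : C * S <= (1 + eta ^+ 2 / 64) * S by rewrite ler_wpM2r// ltW.
have : (1 + eta ^+ 2 / 64) * S <= (1 + eta ^+ 2 / 64) * (4 - eta ^+ 2 / 8).
  by rewrite ler_wpM2l//; lra.
move: hC (exprn_gt0 2 eta0); set y := eta ^+ 2; nra.
Qed.

End Converse.

Theorem theorem10p3p1 (R : realType) (n : nat -> int) (n_inj : injective n) :
  (`|ratio R n k| @[k --> \oo] --> +oo ->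
     realizes_l1map R n /\ sidon_asymptotically_1 R (range n)) /\
  ((forall k : nat, ratio R n k \is a Num.int) ->
     realizes_l1map R n -> sidon_asymptotically_1 R (range n) ->
     `|ratio R n k| @[k --> \oo] --> +oo).
Proof.
split=> [h|hint _]; last exact: ratio_int_infty.
by split; [exact: realizes_l1map_lacunary|exact: sidon_lacunary].
Qed.
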